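(* Let $\{a_n\}_{n=0}^\infty$ be a sequence of complex numbers with $\sup_n|a_n|<\infty$, and let $f(z)=\sum_{n=0}^\infty a_n z^n$ for $z\in\mathbb{D}$. Suppose that for any open interval $I\subset\partial\mathbb{D}$ there is a right limit of $\{a_n\}_{n=0}^\infty$ which is not reflectionless on $I$. Then $f$ has a strong natural boundary on $\partial\mathbb{D}$.
   Context: $\mathbb{D}=\{z\in\mathbb{C}: |z|<1\}$, $\partial\mathbb{D}$ is the unit circle, and an open interval $I\subset\partial\mathbb{D}$ means a nonempty open arc. Right limit: for a bounded sequence $\{a_n\}_{n=0}^\infty$, a right limit is a two-sided sequence $\{b_n\}_{n=-\infty}^\infty$ for which there is a sequence of integers $n_j\to\infty$ with $b_n=\lim_{j\to\infty} a_{n+n_j}$ for every $n\in\mathbb{Z}$. Reflectionless: for a bounded two-sided sequence $\{b_n\}_{n=-\infty}^\infty$, put $f_+(z)=\sum_{n=0}^\infty b_n z^n$ for $z\in\mathbb{D}$ and $f_-(z)=\sum_{n=-\infty}^{-1} b_n z^n$ for $z\in(\mathbb{C}\cup\{\infty\})\setminus\overline{\mathbb{D}}$. The sequence is reflectionless on an open interval $I\subset\partial\mathbb{D}$ if and only if $f_+$ has an analytic continuation from $\mathbb{D}$ to $(\mathbb{C}\cup\{\infty\})\setminus(\partial\mathbb{D}\setminus I)$ such that on $(\mathbb{C}\cup\{\infty\})\setminus\overline{\mathbb{D}}$ the continuation satisfies $f_+(z)+f_-(z)=0$. Strong natural boundary: $f$, analytic on $\mathbb{D}$, has a strong natural boundary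 on $\partial\mathbb{D}$ if for every open interval $I\subset\partial\mathbb{D}$ one has $\sup_{0<r<1}\int_{e^{i\theta}\in I}|f(re^{i\theta})|\,\frac{d\theta}{2\pi}=\infty$. *)

(* Defs.v *)
From Stdlib Require Import Reals ZArith.
From Coquelicot Require Import Coquelicot.
Open Scope R_scope.

(** Convergent complex series are summed componentwise; the value is junk when
    the series diverges. *)
Definition CSeries (u : nat -> C) : C :=
  (Series (fun n => fst (u n)), Series (fun n => snd (u n))).

Definition power_series (a : nat -> C) (z : C) : C :=
  CSeries (fun n => (a n * z ^ n)%C).

(** The arc of the points exp(i t), lo < t < hi.  The length bound makes
    t |-> exp(i t) injective on ]lo, hi[, so that an integral over the arc is an
    integral over ]lo, hi[. *)
Record open_arc : Type := {
  lo : R;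
  hi : R;
  lo_lt_hi : lo < hi;
  hi_le : hi <= lo + 2 * PI
}.

Definition in_arc (I : open_arc) (z : C) : Prop :=
  exists t : R, lo I < t < hi I /\ z = (cos t, sin t).

Definition bounded_seq (a : nat -> C) : Prop :=
  exists M : R, forall n : nat, Cmod (a n) <= M.

(** [Z.to_nat] is harmless here: for fixed [n], [n + nj j] is nonnegative for all
    large [j]. *)
Definition right_limit (a : nat -> C) (b : Z -> C) : Prop :=
  exists nj : nat -> Z,
    (forall m : Z, eventually (fun j => (m <= nj j)%Z)) /\
    (forall n : Z,
       filterlim (fun j => a (Z.to_nat (n + nj j))) eventually (locally (b n))).

(** The Riemann sphere, with [None] as the point at infinity. *)
Definition sphere : Type := option C.

Definition exterior (x : sphere) : Prop :=
  match x with Some z => 1 < Cmod z | None => True end.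

(** The sphere without (unit circle \ I). *)
Definition slit_sphere (I : open_arc) (x : sphere) : Prop :=
  match x with
  | Some z => ~ (Cmod z = 1 /\ ~ in_arc I z)
  | None => True
  end.

(** The inversion w |-> 1/w, a chart of the sphere around infinity. *)
Definition inversion (w : C) : sphere :=
  if Ceq_dec w (RtoC 0) then None else Some (/ w)%C.

Definition complex_differentiable (f : C -> C) (z : C) : Prop :=
  @ex_derive C_AbsRing C_NormedModule f z.

Definition sphere_differentiable (F : sphere -> C) (x : sphere) : Prop :=
  match x with
  | Some z => complex_differentiable (fun w => F (Some w)) z
  | None => complex_differentiable (fun w => F (inversion w)) (RtoC 0)
  end.

(** Meant for open [U], where pointwise complex differentiability is
    analyticity. *)
Definition analytic_on (U : sphere -> Prop) (F : sphere -> C) : Prop :=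
  forall x : sphere, U x -> sphere_differentiable F x.

Definition f_plus (b : Z -> C) (z : C) : C :=
  power_series (fun n => b (Z.of_nat n)) z.

(** The index n <= -1 is written -(k+1); every term vanishes at infinity. *)
Definition f_minus (b : Z -> C) (x : sphere) : C :=
  match x with
  | Some z => CSeries (fun k => (b (- Z.of_nat (S k))%Z * / z ^ S k)%C)
  | None => RtoC 0
  end.

Definition reflectionless (b : Z -> C) (I : open_arc) : Prop :=
  exists F : sphere -> C,
    analytic_on (slit_sphere I) F /\
    (forall z : C, Cmod z < 1 -> F (Some z) = f_plus b z) /\
    (forall x : sphere, exterior x -> (F x + f_minus b x)%C = RtoC 0).

Definition analytic_on_disk (f : C -> C) : Prop :=
  forall z : C, Cmod z < 1 -> complex_differentiable f z.

Definition arc_mean (f : C -> C) (I : open_arc) (r : R) : R :=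
  RInt (fun t => Cmod (f (RtoC r * (cos t, sin t))%C) / (2 * PI)) (lo I) (hi I).

Definition strong_natural_boundary (f : C -> C) : Prop :=
  analytic_on_disk f /\
  forall I : open_arc,
    Lub_Rbar (fun x => exists r : R, 0 < r < 1 /\ x = arc_mean f I r) = p_infty.

(* Main.v *)
Require Import Defs.
From Stdlib Require Import Reals ZArith Lra Lia Psatz Classical.
From Coquelicot Require Import Coquelicot.
Open Scope R_scope.

(** If the arc means over an arc I stay bounded, every right limit of a is
    reflectionless on I; the theorem is the contrapositive, applied to each arc.

    A bounded two-sided sequence b is read as the distribution Sum b_k e^{ikt}:
    [pairing b al be g] is the sum over k of b_k times the integral of
    g(t) e^{ikt} over [al, be], which converges absolutely because the test
    functions g are C^2 with vanishing 1-jets at the endpoints (or periodic, over a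
    full period), so that these integrals are O(1/k^2) ([fourier_decay]).  Being
    reflectionless on I means that this distribution vanishes on I, and the proof
    has two halves.

    Vanishing ([right_limit_pairing_vanishes]).  Let L be the pairing with a,
    extended by 0 to negative indices.  By Abel summation and the bound on the
    arc means, L is bounded for the sup norm on test functions of I: the boundary
    value of f on I is a measure ([arc_norm_bound]).  Also L(g e^{imt}) -> 0 as
    m -> +oo, since a lives on the nonnegative indices.  For a measure this
    forces L(g e^{-imt}) -> 0 as well, a form of a theorem of Rajchman.  The
    argument for [decay_transfer] uses only the norm V of L: if p nearly attains
    V, then p L is nearly a positive functional, so L(q) is nearly the conjugate
    of L(p^2 conj q); with q = g e^{-imt} the latter is L applied to a fixed test
    function times e^{imt}.  Finally L(g e^{-imt}) is the pairing of g with the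
    translate of a by m; along the integers n_j that define a right limit b it
    converges to the pairing of g with b, which is therefore 0.

    Continuation ([pairing_vanishes_reflectionless]).  Pairing b over a full
    period with the Cauchy kernel 1/(1 - z e^{-it}) gives 2 pi f_+(z) inside the
    disk and -2 pi f_-(z) outside.  Near a point of I, split the kernel with a
    cutoff phi supported in I and equal to 1 near that point: phi times the kernel
    is a test function of I and contributes 0, while the remaining part is
    supported away from the point, so its pairing is complex differentiable there,
    across the circle.  This gives the continuation without Cauchy's theorem. *)

(** * Complex numbers and limits of complex sequences *)

Lemma C_ext (z w : C) : Re z = Re w -> Im z = Im w -> z = w.
Proof. destruct z, w; simpl; intros -> ->; reflexivity. Qed.

Lemma im_le_Cmod (z : C) : Rabs (Im z) <= Cmod z.
Proof. eapply Rle_trans; [apply Rmax_r | apply Rmax_Cmod]. Qed.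

Lemma Cmod_le_abs (z : C) : Cmod z <= Rabs (Re z) + Rabs (Im z).
Proof.
  replace z with (RtoC (Re z) + Ci * RtoC (Im z))%C at 1.
  - eapply Rle_trans; [apply Cmod_triangle|].
    rewrite Cmod_mult, Cmod_Ci, !Cmod_R; lra.
  - apply C_ext; simpl; ring.
Qed.

(** Componentwise, so that the real-valued limit and series lemmas apply. *)
Definition Clim (u : nat -> C) (l : C) : Prop :=
  is_lim_seq (fun n => Re (u n)) (Re l) /\ is_lim_seq (fun n => Im (u n)) (Im l).

Lemma Clim_of_Cmod (u : nat -> C) (l : C) (e : nat -> R) :
  is_lim_seq e 0 -> (forall n, Cmod (u n - l) <= e n) -> Clim u l.
Proof.
  intros He Hu.
  assert (Hs : forall v : nat -> R, forall m : R,
             (forall n, Rabs (v n - m) <= e n) -> is_lim_seq v m).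
  { intros v m Hv.
    apply is_lim_seq_ext with (fun n => (v n - m) + m); [intros; ring|].
    replace (Finite m) with (Finite (0 + m)) by (f_equal; ring).
    apply is_lim_seq_plus'; [|apply is_lim_seq_const].
    apply is_lim_seq_abs_0.
    apply is_lim_seq_le_le with (fun _ => 0) e; auto using is_lim_seq_const.
    intros n; split; [apply Rabs_pos|auto]. }
  split; apply Hs; intros n; (eapply Rle_trans; [|apply Hu]).
  - apply (re_le_Cmod (u n - l)).
  - apply (im_le_Cmod (u n - l)).
Qed.

Lemma Clim_Cmod (u : nat -> C) (l : C) :
  Clim u l -> is_lim_seq (fun n => Cmod (u n - l)) 0.
Proof.
  intros [Hr Hi].
  assert (Hz : forall v : nat -> R, forall m : R, is_lim_seq v m ->
             is_lim_seq (fun n => Rabs (v n - m)) 0).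
  { intros v m Hv. apply -> is_lim_seq_abs_0.
    replace 0 with (m - m) by ring.
    apply is_lim_seq_minus'; [exact Hv|apply is_lim_seq_const]. }
  apply is_lim_seq_le_le with (fun _ => 0)
    (fun n => Rabs (Re (u n) - Re l) + Rabs (Im (u n) - Im l)).
  - intros n; split; [apply Cmod_ge_0|apply (Cmod_le_abs (u n - l))].
  - apply is_lim_seq_const.
  - replace 0 with (0 + 0) by ring. apply is_lim_seq_plus'; auto.
Qed.

Lemma Clim_const (c : C) : Clim (fun _ => c) c.
Proof. split; apply is_lim_seq_const. Qed.

Lemma Clim_plus (u v : nat -> C) (a b : C) :
  Clim u a -> Clim v b -> Clim (fun n => u n + v n)%C (a + b)%C.
Proof. intros [H1 H2] [H3 H4]; split; simpl; apply is_lim_seq_plus'; auto. Qed.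

Lemma Clim_mult (u v : nat -> C) (a b : C) :
  Clim u a -> Clim v b -> Clim (fun n => u n * v n)%C (a * b)%C.
Proof.
  intros [H1 H2] [H3 H4]; split; simpl.
  - apply is_lim_seq_minus'; apply is_lim_seq_mult'; auto.
  - apply is_lim_seq_plus'; apply is_lim_seq_mult'; auto.
Qed.

Lemma Clim_ext_loc (u v : nat -> C) (l : C) :
  eventually (fun n => u n = v n) -> Clim u l -> Clim v l.
Proof.
  intros [N HN] [H1 H2]; split; eapply is_lim_seq_ext_loc; eauto;
    exists N; intros n Hn; now rewrite HN.
Qed.

Lemma Clim_unique (u : nat -> C) (a b : C) : Clim u a -> Clim u b -> a = b.
Proof.
  intros [H1 H2] [H3 H4].
  apply is_lim_seq_unique in H1, H2, H3, H4.
  apply C_ext.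
  - rewrite H1 in H3; now injection H3.
  - rewrite H2 in H4; now injection H4.
Qed.

Lemma filterlim_Clim (u : nat -> C) (l : C) :
  filterlim u eventually (@locally C_UniformSpace l) -> Clim u l.
Proof.
  intros H. split.
  - apply (filterlim_comp _ _ _ u (fun y : C => fst y) _ _ _ H).
    apply (continuous_fst (U := R_UniformSpace) (V := R_UniformSpace)).
  - apply (filterlim_comp _ _ _ u (fun y : C => snd y) _ _ _ H).
    apply (continuous_snd (U := R_UniformSpace) (V := R_UniformSpace)).
Qed.

(** * Dominated series *)

Lemma Series_abs_le (u d : nat -> R) :
  ex_series d -> (forall n, Rabs (u n) <= d n) ->
  ex_series u /\ Rabs (Series u) <= Series d.
Proof.
  intros Hd Hu.
  assert (Ha : ex_series (fun n => Rabs (u n))).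
  { apply (ex_series_le (V := R_CompleteNormedModule)) with d; auto.
    intros n. change norm with Rabs. rewrite Rabs_Rabsolu. apply Hu. }
  split; [now apply ex_series_Rabs|].
  eapply Rle_trans; [apply Series_Rabs; exact Ha|].
  apply Series_le; auto. intros n; split; [apply Rabs_pos|apply Hu].
Qed.

Lemma Series_tail_small (d : nat -> R) (eps : R) :
  ex_series d -> 0 < eps ->
  exists N, (0 < N)%nat /\ Rabs (Series (fun k => d (N + k)%nat)) < eps.
Proof.
  intros Hd He.
  pose proof (Series_correct d Hd) as Hs.
  change (is_lim_seq (sum_n d) (Series d)) in Hs.
  apply is_lim_seq_spec in Hs. destruct (Hs (mkposreal eps He)) as [N HN].
  exists (S N). split; [lia|].
  specialize (HN N (Nat.le_refl _)). simpl in HN.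
  rewrite (Series_incr_n d (S N)) in HN; [|lia|exact Hd].
  rewrite sum_n_Reals in HN. simpl Init.Nat.pred in HN.
  rewrite Rabs_minus_sym in HN.
  match goal with |- Rabs ?x < _ => match type of HN with Rabs ?y < _ =>
    replace x with y by ring end end.
  exact HN.
Qed.

Lemma sum_f_R0_lim (u : nat -> nat -> R) (l : nat -> R) (N : nat) :
  (forall n, is_lim_seq (fun j => u j n) (l n)) ->
  is_lim_seq (fun j => sum_f_R0 (u j) N) (sum_f_R0 l N).
Proof.
  intros H; induction N; simpl; auto. apply is_lim_seq_plus'; auto.
Qed.

(** Dominated convergence for series: a finite partial sum converges, and the
    tails are uniformly small. *)
Lemma Series_tannery (u : nat -> nat -> R) (l d : nat -> R) :
  ex_series d -> (forall j n, Rabs (u j n) <= d n) ->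
  (forall n, is_lim_seq (fun j => u j n) (l n)) ->
  is_lim_seq (fun j => Series (u j)) (Series l).
Proof.
  intros Hd Hu Hl.
  assert (Hld : forall n, Rabs (l n) <= d n).
  { intros n. specialize (Hl n). apply is_lim_seq_abs in Hl.
    apply (is_lim_seq_le _ (fun _ => d n) _ (d n)) in Hl;
      auto using is_lim_seq_const. }
  apply is_lim_seq_spec. intros [eps He]. simpl.
  destruct (Series_tail_small d (eps / 3)) as (N & HN0 & HN); auto; [lra|].
  assert (Htail : forall v : nat -> R, (forall n, Rabs (v n) <= d n) ->
     ex_series v /\ Rabs (Series (fun k => v (N + k)%nat)) < eps / 3).
  { intros v Hv. split.
    - now apply (Series_abs_le v d).
    - eapply Rle_lt_trans; [|exact HN].
      eapply Rle_trans; [|apply Rle_abs].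
      apply Series_abs_le.
      + now apply ex_series_incr_n.
      + intros; apply Hv. }
  pose proof (sum_f_R0_lim u l (pred N) Hl) as Hf.
  apply is_lim_seq_spec in Hf.
  assert (He3 : 0 < eps / 3) by lra.
  destruct (Hf (mkposreal _ He3)) as [J HJ]. simpl in HJ.
  exists J. intros j Hj. specialize (HJ j Hj).
  destruct (Htail (u j) (Hu j)) as [E1 T1].
  destruct (Htail l Hld) as [E2 T2].
  rewrite (Series_incr_n (u j) N), (Series_incr_n l N) by auto.
  apply Rabs_def2 in HJ, T1, T2. apply Rabs_def1; lra.
Qed.

Lemma CSeries_ext (u v : nat -> C) :
  (forall n, u n = v n) -> CSeries u = CSeries v.
Proof. intros H; unfold CSeries; f_equal; apply Series_ext; intros; now rewrite H. Qed.

Section Dominated.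
Variables (d : nat -> R) (Hd : ex_series d).

Lemma dominated_Re (u : nat -> C) : (forall n, Cmod (u n) <= d n) ->
  forall n, Rabs (fst (u n)) <= d n.
Proof. intros H n; eapply Rle_trans; [apply re_le_Cmod|apply H]. Qed.

Lemma dominated_Im (u : nat -> C) : (forall n, Cmod (u n) <= d n) ->
  forall n, Rabs (snd (u n)) <= d n.
Proof. intros H n; eapply Rle_trans; [apply im_le_Cmod|apply H]. Qed.

Lemma dominated_ex_Re (u : nat -> C) : (forall n, Cmod (u n) <= d n) ->
  ex_series (fun n => fst (u n)).
Proof. intros H; apply (Series_abs_le _ d); auto using dominated_Re. Qed.

Lemma dominated_ex_Im (u : nat -> C) : (forall n, Cmod (u n) <= d n) ->
  ex_series (fun n => snd (u n)).
Proof. intros H; apply (Series_abs_le _ d); auto using dominated_Im. Qed.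

Lemma CSeries_Cmod_le (u : nat -> C) : (forall n, Cmod (u n) <= d n) ->
  Cmod (CSeries u) <= 2 * Series d.
Proof.
  intros H. eapply Rle_trans; [apply Cmod_le_abs|].
  assert (Rabs (Re (CSeries u)) <= Series d)
    by (apply (Series_abs_le _ d); auto using dominated_Re).
  assert (Rabs (Im (CSeries u)) <= Series d)
    by (apply (Series_abs_le _ d); auto using dominated_Im).
  lra.
Qed.

Lemma CSeries_plus (u v : nat -> C) :
  (forall n, Cmod (u n) <= d n) -> (forall n, Cmod (v n) <= d n) ->
  CSeries (fun n => u n + v n)%C = (CSeries u + CSeries v)%C.
Proof.
  intros Hu Hv. apply C_ext; simpl; apply Series_plus;
    auto using dominated_ex_Re, dominated_ex_Im.
Qed.

Lemma CSeries_scal (c : C) (u : nat -> C) :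
  (forall n, Cmod (u n) <= d n) ->
  CSeries (fun n => c * u n)%C = (c * CSeries u)%C.
Proof.
  intros Hu.
  assert (H1 := dominated_ex_Re u Hu). assert (H2 := dominated_ex_Im u Hu).
  apply C_ext; simpl.
  - rewrite Series_minus; [now rewrite !Series_scal_l| |];
      now apply (ex_series_scal (V := R_NormedModule)).
  - rewrite Series_plus; [now rewrite !Series_scal_l| |];
      now apply (ex_series_scal (V := R_NormedModule)).
Qed.

Lemma CSeries_incr_1 (u : nat -> C) :
  (forall n, Cmod (u n) <= d n) ->
  CSeries u = (u 0%nat + CSeries (fun n => u (S n)))%C.
Proof.
  intros Hu. apply C_ext; simpl; apply Series_incr_1;
    auto using dominated_ex_Re, dominated_ex_Im.
Qed.

Lemma CSeries_tannery (u : nat -> nat -> C) (l : nat -> C) :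
  (forall j n, Cmod (u j n) <= d n) -> (forall n, Clim (fun j => u j n) (l n)) ->
  Clim (fun j => CSeries (u j)) (CSeries l).
Proof.
  intros Hu Hl. split; simpl.
  - apply (Series_tannery (fun j n => fst (u j n)) (fun n => fst (l n)) d); auto.
    + intros j; now apply dominated_Re.
    + intros n; apply Hl.
  - apply (Series_tannery (fun j n => snd (u j n)) (fun n => snd (l n)) d); auto.
    + intros j; now apply dominated_Im.
    + intros n; apply Hl.
Qed.
End Dominated.

(** * Sums over Z of quadratically decaying families *)

(** All sums over Z below are dominated by multiples of this one weight, so a
    single constant controls each of them. *)
Definition weight (k : Z) : R := / (1 + IZR k ^ 2).

Definition quad_dominated (K : R) (u : Z -> C) : Prop :=
  forall k, Cmod (u k) <= K * weight k.

(** Index -(n+1) in the second half, so that 0 is counted once. *)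
Definition Zsum (u : Z -> C) : C :=
  (CSeries (fun n => u (Z.of_nat n)) + CSeries (fun n => u (- Z.of_nat (S n))%Z))%C.

Definition nat_weight (n : nat) : R := weight (Z.of_nat n).

Lemma weight_pos (k : Z) : 0 < weight k.
Proof. apply Rinv_0_lt_compat. nra. Qed.

Lemma weight_opp_S (n : nat) : weight (- Z.of_nat (S n)) <= nat_weight n.
Proof.
  unfold nat_weight, weight. apply Rinv_le_contravar; [nra|].
  rewrite opp_IZR, <- !INR_IZR_INZ, S_INR. pose proof (pos_INR n). nra.
Qed.

Lemma is_lim_inv_INR_add_2 : is_lim_seq (fun n => / (INR n + 2)) 0.
Proof.
  apply is_lim_seq_ext with (fun n => / INR (n + 2)).
  { intros n. now rewrite plus_INR. }
  apply (is_lim_seq_incr_n (fun n => / INR n) 2).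
  replace (Finite 0) with (Rbar_inv p_infty) by reflexivity.
  apply is_lim_seq_inv; [apply is_lim_seq_INR|discriminate].
Qed.

Lemma ex_series_nat_weight : ex_series nat_weight.
Proof.
  (* 4/((n+1)(n+2)) telescopes, and (n+1)(n+2) <= 4(1+n^2) *)
  apply (ex_series_le (V := R_CompleteNormedModule))
    with (fun n => 4 * (/ (INR n + 1) - / (INR n + 2))).
  - intros n. change norm with Rabs. rewrite Rabs_pos_eq by (left; apply weight_pos).
    unfold nat_weight, weight. rewrite <- INR_IZR_INZ.
    pose proof (pos_INR n) as Hn. set (x := INR n) in *.
    replace (4 * (/ (x + 1) - / (x + 2))) with (/ ((x + 1) * (x + 2) / 4))
      by (field; lra).
    apply Rinv_le_contravar; nra.
  - apply (ex_series_scal (V := R_NormedModule)).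
    exists 1. change (is_lim_seq (sum_n (fun n => / (INR n + 1) - / (INR n + 2))) 1).
    apply is_lim_seq_ext with (fun n => 1 - / (INR n + 2)).
    + induction n.
      * rewrite sum_O. simpl. field.
      * rewrite sum_Sn, <- IHn. rewrite S_INR. change plus with Rplus.
        pose proof (pos_INR n). field. lra.
    + replace (Finite 1) with (Finite (1 - 0)) by (f_equal; ring).
      apply is_lim_seq_minus'; [apply is_lim_seq_const|].
      apply is_lim_inv_INR_add_2.
Qed.

Lemma ex_series_scal_weight (K : R) : ex_series (fun n => K * nat_weight n).
Proof. apply (ex_series_scal (V := R_NormedModule)), ex_series_nat_weight. Qed.

Lemma quad_dominated_pos_half (K : R) (u : Z -> C) : quad_dominated K u ->
  forall n, Cmod (u (Z.of_nat n)) <= K * nat_weight n.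
Proof. intros H n; apply H. Qed.

Lemma quad_dominated_nonneg (K : R) (u : Z -> C) : quad_dominated K u -> 0 <= K.
Proof.
  intros H. specialize (H 0%Z). pose proof (Cmod_ge_0 (u 0%Z)).
  pose proof (weight_pos 0). nra.
Qed.

Lemma quad_dominated_neg_half (K : R) (u : Z -> C) : quad_dominated K u ->
  forall n, Cmod (u (- Z.of_nat (S n))%Z) <= K * nat_weight n.
Proof.
  intros H n; eapply Rle_trans; [apply H|].
  apply Rmult_le_compat_l; [eapply quad_dominated_nonneg; eauto|apply weight_opp_S].
Qed.

#[local] Hint Resolve quad_dominated_pos_half quad_dominated_neg_half
  ex_series_scal_weight : zsum.

Definition Zsum_const : R := 4 * Series nat_weight.

Lemma Zsum_Cmod_le (K : R) (u : Z -> C) :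
  quad_dominated K u -> Cmod (Zsum u) <= Zsum_const * K.
Proof.
  intros H. unfold Zsum, Zsum_const.
  eapply Rle_trans; [apply Cmod_triangle|].
  assert (Cmod (CSeries (fun n => u (Z.of_nat n))) <= 2 * (K * Series nat_weight)).
  { rewrite <- Series_scal_l. apply CSeries_Cmod_le; auto with zsum. }
  assert (Cmod (CSeries (fun n => u (- Z.of_nat (S n))%Z)) <= 2 * (K * Series nat_weight)).
  { rewrite <- Series_scal_l. apply CSeries_Cmod_le; auto with zsum. }
  lra.
Qed.

Lemma Zsum_ext (u v : Z -> C) : (forall k, u k = v k) -> Zsum u = Zsum v.
Proof. intros H; unfold Zsum; f_equal; apply CSeries_ext; intros; apply H. Qed.

Lemma quad_dominated_weaken (K L : R) (u : Z -> C) :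
  K <= L -> quad_dominated K u -> quad_dominated L u.
Proof. intros HKL H k. specialize (H k). pose proof (weight_pos k). nra. Qed.

Lemma Zsum_plus (K : R) (u v : Z -> C) :
  quad_dominated K u -> quad_dominated K v ->
  Zsum (fun k => u k + v k)%C = (Zsum u + Zsum v)%C.
Proof.
  intros Hu Hv. unfold Zsum.
  rewrite !(CSeries_plus (fun n => K * nat_weight n)) by auto with zsum. ring.
Qed.

Lemma Zsum_scal (K : R) (c : C) (u : Z -> C) :
  quad_dominated K u -> Zsum (fun k => c * u k)%C = (c * Zsum u)%C.
Proof.
  intros Hu. unfold Zsum.
  rewrite !(CSeries_scal (fun n => K * nat_weight n)) by auto with zsum. ring.
Qed.

Lemma Zsum_tannery (K : R) (u : nat -> Z -> C) (l : Z -> C) :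
  (forall j, quad_dominated K (u j)) -> (forall k, Clim (fun j => u j k) (l k)) ->
  Clim (fun j => Zsum (u j)) (Zsum l).
Proof.
  intros Hu Hl.
  apply Clim_plus; apply (CSeries_tannery (fun n => K * nat_weight n));
    intros; auto with zsum.
Qed.

Lemma Zsum_succ (K : R) (u : Z -> C) :
  quad_dominated K u -> Zsum (fun k => u (k + 1)%Z) = Zsum u.
Proof.
  intros Hu. unfold Zsum.
  rewrite (CSeries_incr_1 (fun n => K * nat_weight n)
             (ex_series_scal_weight K) (fun n => u (Z.of_nat n))) by auto with zsum.
  rewrite (CSeries_ext (fun n => u (Z.of_nat n + 1)%Z) (fun n => u (Z.of_nat (S n))))
    by (intros; f_equal; lia).
  assert (H' : forall n, Cmod (u (- Z.of_nat (S n) + 1)%Z) <= K * nat_weight n).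
  { intros n. replace (- Z.of_nat (S n) + 1)%Z with (- Z.of_nat n)%Z by lia.
    eapply Rle_trans; [apply Hu|]. apply Req_le. f_equal.
    unfold nat_weight, weight. now rewrite opp_IZR, <- Rsqr_pow2, <- Rsqr_neg, Rsqr_pow2. }
  rewrite (CSeries_incr_1 (fun n => K * nat_weight n)
             (ex_series_scal_weight K) (fun n => u (- Z.of_nat (S n) + 1)%Z) H').
  rewrite (CSeries_ext (fun n => u (- Z.of_nat (S (S n)) + 1)%Z)
             (fun n => u (- Z.of_nat (S n))%Z)) by (intros; f_equal; lia).
  simpl (- Z.of_nat 1 + 1)%Z. simpl (Z.of_nat 0). ring.
Qed.

Definition summable (u : Z -> C) : Prop := exists K, quad_dominated K u.

Lemma summable_succ (u : Z -> C) : summable u -> summable (fun k => u (k + 1)%Z).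
Proof.
  intros [K H]. exists (4 * K). intros k. eapply Rle_trans; [apply H|].
  pose proof (quad_dominated_nonneg _ _ H).
  replace (4 * K * weight k) with (K * (4 * weight k)) by ring.
  apply Rmult_le_compat_l; auto.
  unfold weight. rewrite plus_IZR. set (x := IZR k).
  replace (4 * / (1 + x ^ 2)) with (/ ((1 + x ^ 2) / 4)) by (field; nra).
  pose proof (pow2_ge_0 (x + 4 / 3)). pose proof (pow2_ge_0 x).
  apply Rinv_le_contravar; nra.
Qed.

Lemma Zsum_shift (u : Z -> C) (m : nat) :
  summable u -> Zsum (fun k => u (k + Z.of_nat m)%Z) = Zsum u.
Proof.
  revert u. induction m; intros u Hu.
  - apply Zsum_ext; intros; f_equal; lia.
  - destruct (Hu) as [K HK]. rewrite <- (Zsum_succ K u HK).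
    rewrite <- (IHm (fun k => u (k + 1)%Z)) by now apply summable_succ.
    apply Zsum_ext; intros; f_equal; lia.
Qed.

(** * Derivatives and integrals of functions from R to C *)

(** Continuity, derivative and integral are taken on real and imaginary parts, so
    that the real Riemann integral and its fundamental theorem suffice. *)
Definition ccont (f : R -> C) (t : R) : Prop :=
  continuous (fun s => Re (f s)) t /\ continuous (fun s => Im (f s)) t.

Definition cder (f : R -> C) (t : R) (l : C) : Prop :=
  is_derive (fun s => Re (f s)) t (Re l) /\ is_derive (fun s => Im (f s)) t (Im l).

Definition CInt (f : R -> C) (al be : R) : C :=
  (RInt (fun t => Re (f t)) al be, RInt (fun t => Im (f t)) al be).

Definition ccont_on (al be : R) (f : R -> C) : Prop :=
  forall t, al <= t <= be -> ccont f t.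

Lemma continuous_Rplus (f g : R -> R) t :
  continuous f t -> continuous g t -> continuous (fun s => f s + g s) t.
Proof. apply (continuous_plus (V := R_NormedModule)). Qed.

Lemma continuous_Rminus (f g : R -> R) t :
  continuous f t -> continuous g t -> continuous (fun s => f s - g s) t.
Proof. apply (continuous_minus (V := R_NormedModule)). Qed.

Lemma continuous_Rmult (f g : R -> R) t :
  continuous f t -> continuous g t -> continuous (fun s => f s * g s) t.
Proof. apply (continuous_mult (K := R_AbsRing)). Qed.

Lemma ccont_const (c : C) t : ccont (fun _ => c) t.
Proof. split; apply continuous_const. Qed.

Lemma ccont_plus f g t : ccont f t -> ccont g t -> ccont (fun s => f s + g s)%C t.
Proof. intros [] []; split; simpl; apply continuous_Rplus; auto. Qed.

Lemma ccont_mult f g t : ccont f t -> ccont g t -> ccont (fun s => f s * g s)%C t.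
Proof.
  intros [] []; split; simpl; [apply continuous_Rminus|apply continuous_Rplus];
    apply continuous_Rmult; auto.
Qed.

Lemma ccont_Cmod f t : ccont f t -> continuous (fun s => Cmod (f s)) t.
Proof.
  intros [H1 H2]. unfold Cmod.
  apply (continuous_comp (fun s => fst (f s) ^ 2 + snd (f s) ^ 2) sqrt).
  - assert (Hsq : forall g : R -> R, continuous g t -> continuous (fun s => g s ^ 2) t).
    { intros g Hg. apply (continuous_ext (fun s => g s * g s)); [intros; simpl; ring|].
      now apply continuous_Rmult. }
    apply (continuous_Rplus (fun s => fst (f s) ^ 2)); now apply Hsq.
  - apply continuous_sqrt.
Qed.

Lemma is_derive_Rmult (f g : R -> R) t df dg :
  is_derive f t df -> is_derive g t dg ->
  is_derive (fun s => f s * g s) t (df * g t + f t * dg).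
Proof.
  intros H1 H2. apply (is_derive_mult f g t df dg H1 H2). intros; apply Rmult_comm.
Qed.

Lemma cder_ccont f t l : cder f t l -> ccont f t.
Proof.
  intros [H1 H2]; split; apply (ex_derive_continuous (V := R_NormedModule));
    eexists; eauto.
Qed.

Lemma cder_eq f t l l' : cder f t l -> l = l' -> cder f t l'.
Proof. now intros H <-. Qed.

Lemma cder_const (c : C) t : cder (fun _ => c) t (RtoC 0).
Proof. split; apply (is_derive_const (V := R_NormedModule)). Qed.

Lemma cder_plus f g t df dg :
  cder f t df -> cder g t dg -> cder (fun s => f s + g s)%C t (df + dg)%C.
Proof. intros [] []; split; simpl; apply (is_derive_plus (V := R_NormedModule)); auto. Qed.

Lemma cder_mult f g t df dg :
  cder f t df -> cder g t dg ->
  cder (fun s => f s * g s)%C t (df * g t + f t * dg)%C.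
Proof.
  intros [F1 F2] [G1 G2]; split; simpl.
  - eapply is_derive_ext_loc; [apply filter_forall; intros; reflexivity|].
    replace (fst df * fst (g t) - snd df * snd (g t) + (fst (f t) * fst dg - snd (f t) * snd dg))
      with ((fst df * fst (g t) + fst (f t) * fst dg) - (snd df * snd (g t) + snd (f t) * snd dg)) by ring.
    apply (is_derive_minus (V := R_NormedModule)); now apply is_derive_Rmult.
  - replace (fst df * snd (g t) + snd df * fst (g t) + (fst (f t) * snd dg + snd (f t) * fst dg))
      with ((fst df * snd (g t) + fst (f t) * snd dg) + (snd df * fst (g t) + snd (f t) * fst dg)) by ring.
    apply (is_derive_plus (V := R_NormedModule)); now apply is_derive_Rmult.
Qed.

Lemma cder_conj f t df : cder f t df -> cder (fun s => Cconj (f s)) t (Cconj df).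
Proof. intros []; split; simpl; auto. now apply (is_derive_opp (V := R_NormedModule)). Qed.

Lemma ccont_conj f t : ccont f t -> ccont (fun s => Cconj (f s)) t.
Proof. intros []; split; simpl; auto. now apply (continuous_opp (V := R_NormedModule)). Qed.

Lemma CInt_ext f g al be :
  al <= be -> (forall t, al < t < be -> f t = g t) -> CInt f al be = CInt g al be.
Proof.
  intros Hab H. unfold CInt.
  f_equal; apply RInt_ext; intros t; rewrite Rmin_left, Rmax_right by auto;
    intros; now rewrite H.
Qed.

Lemma ex_RInt_on (f : R -> R) al be :
  al <= be -> (forall t, al <= t <= be -> continuous f t) -> ex_RInt f al be.
Proof.
  intros Hab H. apply (ex_RInt_continuous (V := R_CompleteNormedModule)).
  now rewrite Rmin_left, Rmax_right.
Qed.

Lemma ex_Re f al be : al <= be -> ccont_on al be f -> ex_RInt (fun t => Re (f t)) al be.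
Proof. intros Hab H; apply ex_RInt_on; [exact Hab|]; intros t Ht; apply (H t Ht). Qed.

Lemma ex_Im f al be : al <= be -> ccont_on al be f -> ex_RInt (fun t => Im (f t)) al be.
Proof. intros Hab H; apply ex_RInt_on; [exact Hab|]; intros t Ht; apply (H t Ht). Qed.

#[local] Hint Resolve ex_Re ex_Im : cint.

Lemma CInt_plus f g al be :
  al <= be -> ccont_on al be f -> ccont_on al be g ->
  CInt (fun t => f t + g t)%C al be = (CInt f al be + CInt g al be)%C.
Proof.
  intros Hab Hf Hg. apply C_ext; simpl.
  - apply (RInt_plus (V := R_CompleteNormedModule)); auto with cint.
  - apply (RInt_plus (V := R_CompleteNormedModule)); auto with cint.
Qed.

Lemma CInt_scal (c : C) f al be :
  al <= be -> ccont_on al be f ->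
  CInt (fun t => c * f t)%C al be = (c * CInt f al be)%C.
Proof.
  intros Hab Hf.
  assert (H1 := ex_Re f al be Hab Hf). assert (H2 := ex_Im f al be Hab Hf).
  assert (S : forall (l : R) (g : R -> R), ex_RInt g al be ->
             ex_RInt (fun t => l * g t) al be /\ RInt (fun t => l * g t) al be = l * RInt g al be).
  { intros l g Hg. split.
    - now apply (ex_RInt_scal (V := R_NormedModule)).
    - now apply (RInt_scal (V := R_CompleteNormedModule)). }
  apply C_ext; simpl.
  - rewrite <- (proj2 (S (fst c) _ H1)), <- (proj2 (S (snd c) _ H2)).
    apply (RInt_minus (V := R_CompleteNormedModule)); now apply S.
  - rewrite <- (proj2 (S (fst c) _ H2)), <- (proj2 (S (snd c) _ H1)).
    apply (RInt_plus (V := R_CompleteNormedModule)); now apply S.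
Qed.

Lemma CInt_Chasles f al be ga :
  al <= be <= ga -> ccont_on al ga f ->
  CInt f al ga = (CInt f al be + CInt f be ga)%C.
Proof.
  intros [H1 H2] Hf.
  assert (ccont_on al be f) by (intros t Ht; apply Hf; lra).
  assert (ccont_on be ga f) by (intros t Ht; apply Hf; lra).
  apply C_ext; simpl; symmetry;
    apply (RInt_Chasles (V := R_CompleteNormedModule)); auto with cint.
Qed.

Lemma CInt_0 al be f : al <= be -> (forall t, al < t < be -> f t = RtoC 0) ->
  CInt f al be = RtoC 0.
Proof.
  intros Hab H. rewrite (CInt_ext _ (fun _ => RtoC 0)) by auto.
  apply C_ext; simpl; rewrite RInt_const; unfold scal; simpl; unfold mult; simpl; ring.
Qed.

(** The factor 2 is the price of estimating componentwise. *)
Lemma CInt_Cmod_le f (g : R -> R) al be :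
  al <= be -> ccont_on al be f -> ex_RInt g al be ->
  (forall t, al <= t <= be -> Cmod (f t) <= g t) ->
  Cmod (CInt f al be) <= 2 * RInt g al be.
Proof.
  intros Hab Hf Hg H.
  assert (S : forall h : R -> R, ex_RInt h al be ->
             (forall t, al <= t <= be -> Rabs (h t) <= g t) ->
             Rabs (RInt h al be) <= RInt g al be).
  { intros h Hh Hhg.
    apply (norm_RInt_le (V := R_NormedModule) h g al be); auto.
    - now apply (RInt_correct (V := R_CompleteNormedModule)).
    - now apply (RInt_correct (V := R_CompleteNormedModule)). }
  eapply Rle_trans; [apply Cmod_le_abs|]. simpl.
  assert (Rabs (RInt (fun t => Re (f t)) al be) <= RInt g al be).
  { apply S; auto with cint. intros t Ht. eapply Rle_trans; [apply re_le_Cmod|auto]. }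
  assert (Rabs (RInt (fun t => Im (f t)) al be) <= RInt g al be).
  { apply S; auto with cint. intros t Ht. eapply Rle_trans; [apply im_le_Cmod|auto]. }
  unfold Re, Im in *. lra.
Qed.

Lemma CInt_Cmod_le_const f B al be :
  al <= be -> ccont_on al be f ->
  (forall t, al <= t <= be -> Cmod (f t) <= B) ->
  Cmod (CInt f al be) <= 2 * ((be - al) * B).
Proof.
  intros Hab Hf H.
  replace ((be - al) * B) with (RInt (fun _ => B) al be)
    by (rewrite RInt_const; reflexivity).
  apply CInt_Cmod_le; auto. apply ex_RInt_const.
Qed.

Lemma CInt_FTC f df al be :
  al <= be -> (forall t, al <= t <= be -> cder f t (df t)) -> ccont_on al be df ->
  CInt df al be = (f be - f al)%C.
Proof.
  intros Hab Hd Hc.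
  apply C_ext; simpl; apply (is_RInt_unique (V := R_CompleteNormedModule)).
  - apply (is_RInt_derive (V := R_CompleteNormedModule) (fun t => Re (f t)));
      rewrite Rmin_left, Rmax_right by auto; intros t Ht; [apply (Hd t Ht)|apply (Hc t Ht)].
  - apply (is_RInt_derive (V := R_CompleteNormedModule) (fun t => Im (f t)));
      rewrite Rmin_left, Rmax_right by auto; intros t Ht; [apply (Hd t Ht)|apply (Hc t Ht)].
Qed.

Lemma CInt_translate f al be T :
  al <= be -> ccont_on (al + T) (be + T) f ->
  CInt (fun t => f (t + T)) al be = CInt f (al + T) (be + T).
Proof.
  intros Hab Hf.
  assert (S : forall h : R -> R, ex_RInt h (al + T) (be + T) ->
     RInt (fun t => h (t + T)) al be = RInt h (al + T) (be + T)).
  { intros h Hh.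
    pose proof (RInt_comp_lin (V := R_CompleteNormedModule) h 1 T al be) as E.
    rewrite !Rmult_1_l in E. specialize (E Hh). rewrite <- E.
    apply RInt_ext; intros t _. unfold scal; simpl; unfold mult; simpl.
    now rewrite !Rmult_1_l. }
  apply C_ext; simpl.
  - apply (S (fun t => Re (f t))); apply ex_Re; auto; lra.
  - apply (S (fun t => Im (f t))); apply ex_Im; auto; lra.
Qed.

Lemma CInt_period f al be :
  al <= be <= al + 2 * PI -> (forall t, ccont f t) ->
  (forall t, f (t + 2 * PI) = f t) ->
  CInt f al (al + 2 * PI) = CInt f be (be + 2 * PI).
Proof.
  intros Hab Hc Hp.
  rewrite (CInt_Chasles f al be (al + 2 * PI)) by (auto; now intros ? _).
  rewrite (CInt_Chasles f be (al + 2 * PI) (be + 2 * PI)) by (try lra; now intros ? _).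
  rewrite <- (CInt_translate f al be (2 * PI)) by (try lra; now intros ? _).
  rewrite (CInt_ext (fun t => f (t + 2 * PI)) f al be); [ring|lra|auto].
Qed.

(** * The characters exp(i k t) *)

Definition e (k : Z) (t : R) : C := (cos (IZR k * t), sin (IZR k * t)).

Lemma e_0 t : e 0 t = RtoC 1.
Proof. unfold e. rewrite Rmult_0_l, cos_0, sin_0. reflexivity. Qed.

Lemma e_add k l t : e (k + l) t = (e k t * e l t)%C.
Proof.
  unfold e. rewrite plus_IZR, Rmult_plus_distr_r, cos_plus, sin_plus.
  apply C_ext; simpl; ring.
Qed.

Lemma e_conj k t : Cconj (e k t) = e (- k) t.
Proof.
  unfold e, Cconj; simpl. rewrite opp_IZR, Ropp_mult_distr_l_reverse, cos_neg, sin_neg.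
  reflexivity.
Qed.

Lemma e_neg k t : (e k t * e (- k) t)%C = RtoC 1.
Proof. rewrite <- e_add, Z.add_opp_diag_r. apply e_0. Qed.

Lemma Cmod_unit (x : R) : Cmod (cos x, sin x) = 1.
Proof.
  unfold Cmod; simpl fst; simpl snd.
  rewrite <- sqrt_1. f_equal. rewrite <- !Rsqr_pow2. apply (eq_trans (Rplus_comm _ _)), sin2_cos2.
Qed.

Lemma Cmod_e k t : Cmod (e k t) = 1.
Proof. apply Cmod_unit. Qed.

Lemma e_period k t : e k (t + 2 * PI) = e k t.
Proof.
  assert (N : forall n x, (cos (x + INR n * (2 * PI)), sin (x + INR n * (2 * PI))) = (cos x, sin x) :> C).
  { intros n x. replace (x + INR n * (2 * PI)) with (x + 2 * INR n * PI) by ring.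
    now rewrite cos_period, sin_period. }
  unfold e. rewrite Rmult_plus_distr_l.
  destruct (Z_le_gt_dec 0 k) as [Hk|Hk].
  - replace (IZR k) with (INR (Z.to_nat k)) by (rewrite INR_IZR_INZ, Z2Nat.id; auto).
    apply N.
  - rewrite <- (N (Z.to_nat (- k)) (IZR k * t + IZR k * (2 * PI))).
    rewrite INR_IZR_INZ, Z2Nat.id, opp_IZR by lia.
    do 2 f_equal; ring.
Qed.

Lemma e_pow t n : ((cos t, sin t) ^ n)%C = e (Z.of_nat n) t.
Proof.
  induction n.
  - now rewrite e_0.
  - rewrite Cpow_S, IHn, Nat2Z.inj_succ, <- Z.add_1_l, e_add.
    unfold e at 2. now rewrite Rmult_1_l.
Qed.

Lemma cder_e k t : cder (e k) t (Ci * RtoC (IZR k) * e k t)%C.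
Proof.
  split; unfold e; simpl; auto_derive; auto; ring.
Qed.

Lemma ccont_e k t : ccont (e k) t.
Proof. eapply cder_ccont, cder_e. Qed.

(** * Test functions *)

(** The derivatives are explicit and share one bound with the function: the
    differentiability of Cauchy transforms needs bounds on test functions that are
    uniform in a parameter. *)
Definition C2 (al be B : R) (f f1 f2 : R -> C) : Prop :=
  forall t, al <= t <= be ->
    cder f t (f1 t) /\ cder f1 t (f2 t) /\ ccont f2 t /\
    Cmod (f t) <= B /\ Cmod (f1 t) <= B /\ Cmod (f2 t) <= B.

(** Multiplying by such a function preserves both boundary conditions of [test]. *)
Definition multiplier (al be B : R) (f : R -> C) : Prop :=
  exists f1 f2, C2 al be B f f1 f2 /\
    (be = al + 2 * PI -> f al = f be /\ f1 al = f1 be).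

(** Either boundary condition cancels the boundary terms of two integrations by
    parts against a character: periodicity over a full period, or vanishing of the
    function and its derivative at both ends. *)
Definition test (al be B : R) (f : R -> C) : Prop :=
  exists f1 f2, C2 al be B f f1 f2 /\
    ((be = al + 2 * PI /\ f al = f be /\ f1 al = f1 be) \/
     (f al = RtoC 0 /\ f be = RtoC 0 /\ f1 al = RtoC 0 /\ f1 be = RtoC 0)).

Ltac split_C2 := split; [|split; [|split; [|split; [|split]]]].

Section Tests.
Variables al be : R.

Lemma test_multiplier B f : test al be B f -> multiplier al be B f.
Proof.
  intros (f1 & f2 & H & Hb). exists f1, f2. split; auto.
  intros _. destruct Hb as [(_ & ? & ?)|(-> & -> & -> & ->)]; auto.
Qed.

Lemma multiplier_ccont B f : multiplier al be B f -> ccont_on al be f.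
Proof.
  intros (f1 & f2 & H & _) t Ht. destruct (H t Ht) as [D _].
  exact (cder_ccont _ _ _ D).
Qed.

Lemma test_ccont B f : test al be B f -> ccont_on al be f.
Proof. intros H; eapply multiplier_ccont, test_multiplier, H. Qed.

Lemma test_bound B f : test al be B f -> forall t, al <= t <= be -> Cmod (f t) <= B.
Proof. intros (f1 & f2 & H & _) t Ht. apply (H t Ht). Qed.

Lemma test_B_nonneg (Hab : al <= be) B f : test al be B f -> 0 <= B.
Proof.
  intros H. eapply Rle_trans; [apply Cmod_ge_0|]. apply (test_bound _ _ H al); lra.
Qed.

Lemma C2_plus A B f f1 f2 g g1 g2 :
  C2 al be A f f1 f2 -> C2 al be B g g1 g2 ->
  C2 al be (A + B) (fun t => f t + g t)%C (fun t => f1 t + g1 t)%C (fun t => f2 t + g2 t)%C.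
Proof.
  intros Hf Hg t Ht. destruct (Hf t Ht) as (?&?&?&?&?&?). destruct (Hg t Ht) as (?&?&?&?&?&?).
  split_C2; try (eapply Rle_trans; [apply Cmod_triangle|lra]).
  - now apply cder_plus.
  - now apply cder_plus.
  - now apply ccont_plus.
Qed.

Lemma C2_mult A B f f1 f2 g g1 g2 :
  C2 al be A f f1 f2 -> C2 al be B g g1 g2 ->
  C2 al be (4 * (A * B)) (fun t => f t * g t)%C
    (fun t => f1 t * g t + f t * g1 t)%C
    (fun t => f2 t * g t + f1 t * g1 t + (f1 t * g1 t + f t * g2 t))%C.
Proof.
  intros Hf Hg t Ht. destruct (Hf t Ht) as (?&?&?&?&?&?). destruct (Hg t Ht) as (?&?&?&?&?&?).
  assert (M : forall x y, Cmod x <= A -> Cmod y <= B -> Cmod (x * y) <= A * B).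
  { intros x y Hx Hy. rewrite Cmod_mult. apply Rmult_le_compat; auto using Cmod_ge_0. }
  assert (P : 0 <= A * B).
  { apply Rmult_le_pos; (eapply Rle_trans; [apply Cmod_ge_0|eassumption]). }
  assert (T : forall x y X Y, Cmod x <= X -> Cmod y <= Y -> Cmod (x + y) <= X + Y).
  { intros. eapply Rle_trans; [apply Cmod_triangle|lra]. }
  assert (ccont f t) by (eapply cder_ccont; eauto).
  assert (ccont g t) by (eapply cder_ccont; eauto).
  assert (ccont f1 t) by (eapply cder_ccont; eauto).
  assert (ccont g1 t) by (eapply cder_ccont; eauto).
  split_C2.
  - now apply cder_mult.
  - apply cder_plus; now apply cder_mult.
  - apply ccont_plus; apply ccont_plus; now apply ccont_mult.
  - eapply Rle_trans; [now apply M|lra].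
  - eapply Rle_trans; [apply T; now apply M|lra].
  - eapply Rle_trans; [apply T; apply T; now apply M|lra].
Qed.

Lemma multiplier_mult A B f g :
  multiplier al be A f -> multiplier al be B g ->
  multiplier al be (4 * (A * B)) (fun t => f t * g t)%C.
Proof.
  intros (f1 & f2 & Hf & Pf) (g1 & g2 & Hg & Pg).
  do 2 eexists. split; [apply C2_mult; eauto|].
  intros E. destruct (Pf E) as [E1 E2], (Pg E) as [E3 E4]. simpl.
  now rewrite E1, E2, E3, E4.
Qed.

Lemma test_mult A B f g :
  test al be A f -> multiplier al be B g ->
  test al be (4 * (A * B)) (fun t => f t * g t)%C.
Proof.
  intros (f1 & f2 & Hf & Pf) (g1 & g2 & Hg & Pg).
  do 2 eexists. split; [apply C2_mult; eauto|]. simpl.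
  destruct Pf as [(E & E1 & E2)|(E1 & E2 & E3 & E4)].
  - left. split; auto. destruct (Pg E) as [E3 E4]. now rewrite E1, E2, E3, E4.
  - right. rewrite E1, E2, E3, E4. repeat split; ring.
Qed.

Lemma test_plus A B f g :
  test al be A f -> test al be B g ->
  test al be (A + B) (fun t => f t + g t)%C.
Proof.
  intros (f1 & f2 & Hf & Pf) (g1 & g2 & Hg & Pg).
  do 2 eexists. split; [apply C2_plus; eauto|]. simpl.
  destruct Pf as [(E & E1 & E2)|(E1 & E2 & E3 & E4)], Pg as [(F & F1 & F2)|(F1 & F2 & F3 & F4)].
  - left. now rewrite E1, E2, F1, F2.
  - left. now rewrite E1, E2, F1, F2, F3, F4.
  - left. now rewrite E1, E2, E3, E4, F1, F2.
  - right. rewrite E1, E2, E3, E4, F1, F2, F3, F4. repeat split; ring.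
Qed.

Lemma multiplier_const c : multiplier al be (Cmod c) (fun _ => c).
Proof.
  exists (fun _ => RtoC 0), (fun _ => RtoC 0). split; auto.
  intros t _. pose proof (Cmod_ge_0 c).
  rewrite Cmod_0. split_C2; try apply cder_const; try apply ccont_const; lra.
Qed.

Lemma multiplier_e k : multiplier al be (1 + IZR k ^ 2) (e k).
Proof.
  exists (fun t => Ci * RtoC (IZR k) * e k t)%C.
  exists (fun t => Ci * RtoC (IZR k) * (Ci * RtoC (IZR k) * e k t))%C. split.
  - intros t _.
    rewrite !Cmod_mult, Cmod_e, Cmod_Ci, Cmod_R.
    assert (Rabs (IZR k) ^ 2 = IZR k ^ 2) by apply pow2_abs.
    pose proof (Rabs_pos (IZR k)).
    split; [apply cder_e|]. split.
    { eapply cder_eq.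
      - apply (cder_mult (fun _ => Ci * RtoC (IZR k))%C (e k)); [apply cder_const|apply cder_e].
      - ring. }
    split.
    { apply ccont_mult; [apply ccont_const|]. apply ccont_mult; [apply ccont_const|apply ccont_e]. }
    repeat split; nra.
  - intros ->. now rewrite e_period.
Qed.

Lemma test_conj B f : test al be B f -> test al be B (fun t => Cconj (f t)).
Proof.
  intros (f1 & f2 & Hf & Pf).
  exists (fun t => Cconj (f1 t)), (fun t => Cconj (f2 t)). split.
  - intros t Ht. destruct (Hf t Ht) as (?&?&?&?&?&?). rewrite !Cmod_conj.
    split_C2; auto using cder_conj, ccont_conj.
  - destruct Pf as [(E & E1 & E2)|(E1 & E2 & E3 & E4)]; [left|right];
      [rewrite E1, E2|rewrite E1, E2, E3, E4]; repeat split; auto;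
      apply C_ext; simpl; ring.
Qed.

Lemma test_0 : test al be 0 (fun _ => RtoC 0).
Proof.
  exists (fun _ => RtoC 0), (fun _ => RtoC 0). split; auto.
  intros t _. rewrite Cmod_0. split_C2; try apply cder_const; try apply ccont_const; lra.
Qed.

Lemma test_ext B f g : (forall t, f t = g t) -> test al be B f -> test al be B g.
Proof.
  intros E (f1 & f2 & H & P). exists f1, f2. rewrite <- !E. split; auto.
  intros t Ht. destruct (H t Ht) as ([D1 D2] & R). rewrite <- !E.
  split; auto. split; (eapply is_derive_ext; [|eassumption]); intros; simpl; now rewrite E.
Qed.

Lemma test_scal B c f : test al be B f -> test al be (4 * (B * Cmod c)) (fun t => c * f t)%C.
Proof.
  intros H. apply test_ext with (fun t => f t * c)%C; [intros; ring|].
  now apply test_mult, multiplier_const.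
Qed.
End Tests.

(** * Fourier coefficients and the pairing with a sequence *)

Definition fourier (al be : R) (f : R -> C) (k : Z) : C :=
  CInt (fun t => f t * e k t)%C al be.

Definition pairing (b : Z -> C) (al be : R) (f : R -> C) : C :=
  Zsum (fun k => b k * fourier al be f k)%C.

Definition zbounded (M : R) (b : Z -> C) : Prop := forall k, Cmod (b k) <= M.

Lemma ccont_on_mult_e al be f k :
  ccont_on al be f -> ccont_on al be (fun t => f t * e k t)%C.
Proof. intros H t Ht. apply ccont_mult; [now apply H|apply ccont_e]. Qed.

Lemma Cmod_fourier_le al be B f k :
  al <= be -> ccont_on al be f -> (forall t, al <= t <= be -> Cmod (f t) <= B) ->
  Cmod (fourier al be f k) <= 2 * ((be - al) * B).
Proof.
  intros Hab Hc H. apply CInt_Cmod_le_const; auto using ccont_on_mult_e.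
  intros t Ht. rewrite Cmod_mult, Cmod_e, Rmult_1_r. auto.
Qed.

(** Two integrations by parts at once: f e_k / (i k) + f' e_k / k^2 is an
    antiderivative of f e_k + f'' e_k / k^2. *)
Lemma fourier_by_parts al be f f1 f2 B k :
  al <= be -> k <> 0%Z -> C2 al be B f f1 f2 ->
  ((be = al + 2 * PI /\ f al = f be /\ f1 al = f1 be) \/
   (f al = RtoC 0 /\ f be = RtoC 0 /\ f1 al = RtoC 0 /\ f1 be = RtoC 0)) ->
  fourier al be f k = (- RtoC (/ IZR k ^ 2) * fourier al be f2 k)%C.
Proof.
  intros Hab Hk HC Hb.
  assert (Hx : IZR k <> 0) by (now apply not_0_IZR).
  set (x := IZR k) in *.
  set (H := fun t => ((f t * (- Ci * RtoC (/ x)) + f1 t * RtoC (/ x ^ 2)) * e k t)%C).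
  assert (Hx2 : (RtoC (/ x ^ 2) * RtoC x = RtoC (/ x))%C).
  { rewrite <- RtoC_mult. f_equal. field; auto. }
  assert (Hx1 : (RtoC (/ x) * RtoC x = RtoC 1)%C).
  { rewrite <- RtoC_mult. f_equal. field; auto. }
  assert (HI2 : (Ci * Ci = - RtoC 1)%C) by (apply C_ext; simpl; ring).
  assert (HD : forall t, al <= t <= be ->
     cder H t (f t * e k t + RtoC (/ x ^ 2) * (f2 t * e k t))%C).
  { intros t Ht. destruct (HC t Ht) as (D1 & D2 & _).
    eapply cder_eq.
    - apply cder_mult; [|apply cder_e].
      apply cder_plus.
      + apply (cder_mult f (fun _ => (- Ci * RtoC (/ x))%C)); [exact D1|apply cder_const].
      + apply (cder_mult f1 (fun _ => RtoC (/ x ^ 2))); [exact D2|apply cder_const].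
    - fold x.
      transitivity ((f t * (- (Ci * Ci) * (RtoC (/ x) * RtoC x)) * e k t
                     + f1 t * e k t * Ci * (RtoC (/ x ^ 2) * RtoC x - RtoC (/ x))
                     + RtoC (/ x ^ 2) * (f2 t * e k t)))%C; [ring|].
      rewrite Hx1, Hx2, HI2. ring. }
  assert (Hf : ccont_on al be (fun t => f t * e k t)%C).
  { apply ccont_on_mult_e. intros t Ht. destruct (HC t Ht) as (D1 & _).
    exact (cder_ccont _ _ _ D1). }
  assert (Hf2 : ccont_on al be (fun t => f2 t * e k t)%C).
  { apply ccont_on_mult_e. intros t Ht. now destruct (HC t Ht) as (_ & _ & ? & _). }
  assert (HS : (fourier al be f k + RtoC (/ x ^ 2) * fourier al be f2 k)%C = RtoC 0).
  { unfold fourier. rewrite <- CInt_scal, <- CInt_plus; auto.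
    2: { intros t Ht. apply ccont_mult; [apply ccont_const|now apply Hf2]. }
    rewrite (CInt_FTC H); auto.
    - unfold H. destruct Hb as [(-> & <- & <-)|(-> & -> & -> & ->)].
      + rewrite e_period. ring.
      + ring.
    - intros t Ht. apply ccont_plus; [now apply Hf|].
      apply ccont_mult; [apply ccont_const|now apply Hf2]. }
  set (u := fourier al be f k) in *. set (v := (RtoC (/ x ^ 2) * fourier al be f2 k)%C) in *.
  transitivity (u + v - v)%C; [ring|]. rewrite HS. unfold v. ring.
Qed.

Lemma fourier_decay al be B f :
  al <= be -> test al be B f ->
  quad_dominated (4 * ((be - al) * B)) (fourier al be f).
Proof.
  intros Hab Ht k.
  assert (HB := test_B_nonneg al be Hab B f Ht).
  set (A := (be - al) * B). assert (HA : 0 <= A) by (apply Rmult_le_pos; lra).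
  destruct (Z.eq_dec k 0) as [->|Hk].
  - unfold weight. replace (4 * A * / (1 + 0 ^ 2)) with (4 * A) by field.
    eapply Rle_trans; [apply (Cmod_fourier_le al be B)|fold A; lra]; auto.
    + eapply test_ccont; eauto.
    + eapply test_bound; eauto.
  - destruct Ht as (f1 & f2 & HC & Hb).
    rewrite (fourier_by_parts al be f f1 f2 B k) by auto.
    assert (Hx2 : 1 <= IZR k ^ 2).
    { replace (IZR k ^ 2) with (IZR (k * k)) by (rewrite mult_IZR; ring). apply IZR_le. nia. }
    rewrite Cmod_mult, Cmod_opp, Cmod_R, Rabs_pos_eq
      by (left; apply Rinv_0_lt_compat; lra).
    assert (E : Cmod (fourier al be f2 k) <= 2 * A).
    { apply Cmod_fourier_le; auto; intros t Ht; destruct (HC t Ht) as (?&?&?&?&?&?); auto. }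
    unfold weight. set (y := IZR k ^ 2) in *.
    apply Rle_trans with (/ y * (2 * A)).
    + apply Rmult_le_compat_l; auto. left; apply Rinv_0_lt_compat; lra.
    + replace (4 * A * / (1 + y)) with (/ ((1 + y) / 2) * (2 * A)) by (field; lra).
      apply Rmult_le_compat_r; [lra|]. apply Rinv_le_contravar; lra.
Qed.

Section Pairing.
Variables (al be : R) (Hab : al <= be) (M : R) (b : Z -> C) (Hb : zbounded M b).

Lemma zbounded_nonneg : 0 <= M.
Proof. eapply Rle_trans; [apply Cmod_ge_0|apply (Hb 0%Z)]. Qed.

Lemma pairing_dominated B f : test al be B f ->
  quad_dominated (M * (4 * ((be - al) * B))) (fun k => b k * fourier al be f k)%C.
Proof.
  intros H k. rewrite Cmod_mult, Rmult_assoc.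
  apply Rmult_le_compat; auto using Cmod_ge_0. now apply fourier_decay.
Qed.

Lemma pairing_Cmod_le B f : test al be B f ->
  Cmod (pairing b al be f) <= Zsum_const * (M * (4 * ((be - al) * B))).
Proof. intros H. apply Zsum_Cmod_le. now apply pairing_dominated. Qed.

Lemma pairing_plus A B f g : test al be A f -> test al be B g ->
  pairing b al be (fun t => f t + g t)%C = (pairing b al be f + pairing b al be g)%C.
Proof.
  intros Hf Hg. unfold pairing.
  pose proof (test_B_nonneg al be Hab A f Hf). pose proof (test_B_nonneg al be Hab B g Hg).
  pose proof zbounded_nonneg.
  rewrite <- (Zsum_plus (M * (4 * ((be - al) * (A + B))))).
  - apply Zsum_ext; intros k. rewrite <- Cmult_plus_distr_l. f_equal.
    unfold fourier. rewrite <- CInt_plus; auto.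
    + apply CInt_ext; auto. intros; ring.
    + apply ccont_on_mult_e. eapply test_ccont; eauto.
    + apply ccont_on_mult_e. eapply test_ccont; eauto.
  - eapply quad_dominated_weaken; [|eapply pairing_dominated; eassumption].
    apply Rmult_le_compat_l; auto. apply Rmult_le_compat_l; [lra|].
    apply Rmult_le_compat_l; lra.
  - eapply quad_dominated_weaken; [|eapply pairing_dominated; eassumption].
    apply Rmult_le_compat_l; auto. apply Rmult_le_compat_l; [lra|].
    apply Rmult_le_compat_l; lra.
Qed.

Lemma pairing_scal B c f : test al be B f ->
  pairing b al be (fun t => c * f t)%C = (c * pairing b al be f)%C.
Proof.
  intros Hf. unfold pairing.
  rewrite <- (Zsum_scal (M * (4 * ((be - al) * B)))) by now apply pairing_dominated.
  apply Zsum_ext; intros k. unfold fourier.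
  rewrite (CInt_ext _ (fun t => c * (f t * e k t))%C); auto.
  - rewrite CInt_scal; auto; [ring|]. apply ccont_on_mult_e. eapply test_ccont; eauto.
  - intros; ring.
Qed.

Lemma pairing_ext f g : (forall t, al < t < be -> f t = g t) ->
  pairing b al be f = pairing b al be g.
Proof.
  intros H. apply Zsum_ext; intros k. unfold fourier. f_equal.
  apply CInt_ext; auto. intros t Ht. now rewrite H.
Qed.
End Pairing.

(** This is how the translates a_(n + n_j) of a sequence enter the pairing. *)
Lemma pairing_e_pos al be M b B f (m : nat) :
  al <= be -> zbounded M b -> test al be B f ->
  pairing b al be (fun t => f t * e (Z.of_nat m) t)%C =
  pairing (fun k => b (k - Z.of_nat m)%Z) al be f.
Proof.
  intros Hab Hb Hf. unfold pairing.
  rewrite <- (Zsum_shift (fun k => b (k - Z.of_nat m)%Z * fourier al be f k)%C m).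
  - apply Zsum_ext; intros k. f_equal; [f_equal; lia|].
    unfold fourier. apply CInt_ext; auto. intros t _. rewrite e_add. ring.
  - eexists.
    exact (pairing_dominated al be Hab M (fun k => b (k - Z.of_nat m)%Z) (fun k => Hb _) B f Hf).
Qed.

Lemma pairing_e_neg al be M b B f (m : nat) :
  al <= be -> zbounded M b -> test al be B f ->
  pairing b al be (fun t => f t * e (- Z.of_nat m)%Z t)%C =
  pairing (fun k => b (k + Z.of_nat m)%Z) al be f.
Proof.
  intros Hab Hb Hf.
  assert (H := test_mult al be _ _ _ _ Hf (multiplier_e al be (- Z.of_nat m))).
  pose proof (pairing_e_pos al be M (fun k => b (k + Z.of_nat m)%Z) _ _ m Hab (fun k => Hb _) H) as E.
  simpl in E.
  rewrite (pairing_ext al be Hab _ _ f) in E.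
  - rewrite E. unfold pairing. apply Zsum_ext; intros k. do 2 f_equal. lia.
  - intros t _. rewrite <- Cmult_assoc, <- e_add.
    rewrite Z.add_opp_diag_l, e_0. ring.
Qed.

(** Bounded pointwise convergence of the sequences is enough, because the Fourier
    coefficients of the test function dominate. *)
Lemma pairing_lim al be M B f (bj : nat -> Z -> C) b :
  al <= be -> test al be B f -> (forall j, zbounded M (bj j)) ->
  (forall k, Clim (fun j => bj j k) (b k)) ->
  Clim (fun j => pairing (bj j) al be f) (pairing b al be f).
Proof.
  intros Hab Hf Hb Hl. unfold pairing.
  apply (Zsum_tannery (M * (4 * ((be - al) * B)))).
  - intros j. now apply pairing_dominated.
  - intros k. apply Clim_mult; [apply Hl|apply Clim_const].
Qed.

Lemma Zsum_0 u : (forall k, u k = RtoC 0) -> Zsum u = RtoC 0.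
Proof.
  intros H. pose proof (Zsum_Cmod_le 0 u) as E. rewrite Rmult_0_r in E.
  apply Cmod_eq_0. apply Rle_antisym; [|apply Cmod_ge_0]. apply E.
  intros k. rewrite H, Cmod_0. lra.
Qed.

Lemma pairing_0_seq al be f : pairing (fun _ => RtoC 0) al be f = RtoC 0.
Proof. apply Zsum_0; intros; ring. Qed.

Definition extend0 (a : nat -> C) (k : Z) : C :=
  if (k <? 0)%Z then RtoC 0 else a (Z.to_nat k).

Lemma zbounded_extend0 M a : (forall n, Cmod (a n) <= M) -> zbounded M (extend0 a).
Proof.
  intros H k. unfold extend0. destruct (k <? 0)%Z; auto.
  rewrite Cmod_0. eapply Rle_trans; [apply Cmod_ge_0|apply (H 0%nat)].
Qed.

(** The oscillation e^{imt} translates the sequence by m, which moves the support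
    of an extension by 0 out of any fixed window. *)
Lemma pairing_extend0_e_pos al be M a B f :
  al <= be -> (forall n, Cmod (a n) <= M) -> test al be B f ->
  Clim (fun m => pairing (extend0 a) al be (fun t => f t * e (Z.of_nat m) t)%C) (RtoC 0).
Proof.
  intros Hab Ha Hf. assert (Hb := zbounded_extend0 M a Ha).
  apply (Clim_ext_loc (fun m => pairing (fun k => extend0 a (k - Z.of_nat m)%Z) al be f)).
  { exists 0%nat. intros m _. symmetry. eapply pairing_e_pos; eauto. }
  rewrite <- (pairing_0_seq al be f).
  apply pairing_lim with M B; auto; [intros j k; apply Hb|].
  intros k. apply (Clim_ext_loc (fun _ => RtoC 0)); [|apply Clim_const].
  exists (S (Z.to_nat k)). intros m Hm. unfold extend0.
  destruct (Z.ltb_spec (k - Z.of_nat m) 0); auto. lia.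
Qed.

(** * Decay in one direction implies decay in the other *)

(** Perturbing p by the direction q - p^2 conj q changes the modulus only to second
    order where |p| = 1, since the direction is then tangent to the circle; and
    where |p| < 1 the first-order term is at most 2t|p|(1 - |p|^2), which the
    missing 1 - |p|^2 absorbs. *)
Lemma Cmod_perturbation (p q : C) (t : R) :
  Cmod p <= 1 -> Cmod q <= 1 -> 0 <= t <= 1 / 2 ->
  Cmod (p + RtoC t * (q - p * p * Cconj q)) <= 1 + 2 * t ^ 2.
Proof.
  intros Hp Hq Ht.
  set (w := (q - p * p * Cconj q)%C).
  assert (Hw : Cmod w <= 2).
  { unfold w, Cminus. eapply Rle_trans; [apply Cmod_triangle|].
    rewrite Cmod_opp, !Cmod_mult, Cmod_conj.
    pose proof (Cmod_ge_0 p). pose proof (Cmod_ge_0 q).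
    assert (Cmod p * Cmod p <= 1) by nra. nra. }
  set (s := Re p * Re q + Im p * Im q).
  assert (Hs : s <= 1).
  { replace s with (Re (Cconj p * q)) by (unfold s; destruct p, q; simpl; ring).
    eapply Rle_trans; [apply Rle_abs|]. eapply Rle_trans; [apply re_le_Cmod|].
    rewrite Cmod_mult, Cmod_conj. pose proof (Cmod_ge_0 p). pose proof (Cmod_ge_0 q). nra. }
  assert (E : Cmod (p + RtoC t * w) ^ 2 =
     Cmod p ^ 2 + 2 * t * ((1 - Cmod p ^ 2) * s) + t ^ 2 * Cmod w ^ 2).
  { rewrite !Cmod2_alt. unfold w, s. destruct p, q; simpl. ring. }
  pose proof (Cmod_ge_0 p). pose proof (Cmod_ge_0 w).
  assert (Cmod p ^ 2 <= 1) by nra. assert (Cmod w ^ 2 <= 4) by nra.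
  assert (Ht2 : 0 <= t ^ 2) by nra.
  assert ((1 - Cmod p ^ 2) * s <= 1 - Cmod p ^ 2) by nra.
  assert (2 * t * ((1 - Cmod p ^ 2) * s) <= 1 - Cmod p ^ 2) by nra.
  assert (F : Cmod (p + RtoC t * w) ^ 2 <= (1 + 2 * t ^ 2) ^ 2).
  { rewrite E. assert (t ^ 2 * Cmod w ^ 2 <= t ^ 2 * 4) by (apply Rmult_le_compat_l; auto).
    assert (0 <= t ^ 2 * t ^ 2) by nra. nra. }
  apply Rsqr_incr_0_var; [rewrite !Rsqr_pow2; exact F|nra].
Qed.

Lemma rotate_to_Cmod (z : C) :
  exists w, Cmod w = 1 /\ (w * z)%C = RtoC (Cmod z).
Proof.
  destruct (Ceq_dec z (RtoC 0)) as [->|Hz].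
  - exists (RtoC 1). rewrite Cmod_1, Cmod_0. split; auto. ring.
  - assert (Hm : Cmod z <> 0) by (apply Cmod_gt_0 in Hz; lra).
    exists (Cconj z * RtoC (/ Cmod z))%C. split.
    + rewrite Cmod_mult, Cmod_conj, Cmod_R, Rabs_pos_eq.
      * now field.
      * left; apply Rinv_0_lt_compat, Cmod_gt_0; auto.
    + replace (Cconj z * RtoC (/ Cmod z) * z)%C with (z * Cconj z * RtoC (/ Cmod z))%C by ring.
      rewrite <- Cmod2_conj, <- RtoC_mult. f_equal. now field.
Qed.

Section Rajchman.
Variables (al be : R) (Hab : al <= be) (M : R) (b : Z -> C) (Hb : zbounded M b).

Let L := pairing b al be.

Definition unit_bounded (f : R -> C) : Prop := forall t, al <= t <= be -> Cmod (f t) <= 1.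

Definition norm_bound (V : R) : Prop :=
  forall B f, test al be B f -> unit_bounded f -> Re (L f) <= V.

Lemma norm_bound_scaled V c B f :
  norm_bound V -> 0 < c -> test al be B f -> (forall t, al <= t <= be -> Cmod (f t) <= c) ->
  Re (L f) <= c * V.
Proof.
  intros HV Hc Hf H.
  pose proof (test_scal al be B (RtoC (/ c)) f Hf) as Hg.
  assert (E : Re (L (fun t => RtoC (/ c) * f t)%C) <= V).
  { eapply HV; eauto. intros t Ht. rewrite Cmod_mult, Cmod_R, Rabs_pos_eq
      by (left; now apply Rinv_0_lt_compat).
    specialize (H t Ht). apply Rmult_le_reg_l with c; auto. rewrite <- Rmult_assoc, Rinv_r by lra. lra. }
  unfold L in *. rewrite (pairing_scal al be Hab M b Hb B) in E by auto.
  simpl in E. rewrite Rmult_0_l, Rminus_0_r in E.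
  apply Rmult_le_reg_l with (/ c); [now apply Rinv_0_lt_compat|].
  rewrite <- Rmult_assoc, Rinv_l, Rmult_1_l by lra. exact E.
Qed.

(** Testing L against the perturbation of p in the direction q - p^2 conj q, with q
    rotated so that L q becomes nonnegative: the value cannot exceed V by more than
    a multiple of t^2, so the first-order gain |L q| - |L(p^2 conj q)| is at most a
    multiple of t. *)
Lemma near_extremal_symmetry V t A B p q :
  norm_bound V -> 0 < t <= 1 / 2 ->
  test al be A p -> unit_bounded p -> test al be B q -> unit_bounded q ->
  V - t ^ 2 <= Re (L p) ->
  Cmod (L q) <= t * (1 + 2 * V) + Cmod (L (fun x => p x * p x * Cconj (q x))%C).
Proof.
  intros HV Ht Hp Up Hq Uq Hext.
  destruct (rotate_to_Cmod (L q)) as (w & Hw1 & Hw2).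
  assert (HX := test_mult al be _ _ _ _ (test_mult al be _ _ _ _ Hp (test_multiplier al be _ _ Hp))
                  (test_multiplier al be _ _ (test_conj al be _ _ Hq))).
  set (X := (fun x => p x * p x * Cconj (q x))%C) in *.
  assert (Hg := test_plus al be _ _ _ _ Hp (test_plus al be _ _ _ _
          (test_scal al be _ (RtoC t * w) _ Hq) (test_scal al be _ (- (RtoC t * Cconj w)) _ HX))).
  set (g := fun x => (p x + (RtoC t * w * q x + - (RtoC t * Cconj w) * X x))%C) in *.
  assert (Eg : L g = (L p + (RtoC t * w * L q + - (RtoC t * Cconj w) * L X))%C).
  { unfold L, g.
    erewrite (pairing_plus al be Hab M b Hb); [|eassumption|].
    2: { eapply test_plus; [apply (test_scal al be _ (RtoC t * w) _ Hq)|
           apply (test_scal al be _ (- (RtoC t * Cconj w)) _ HX)]. }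
    erewrite (pairing_plus al be Hab M b Hb);
      [|apply (test_scal al be _ (RtoC t * w) _ Hq)|apply (test_scal al be _ (- (RtoC t * Cconj w)) _ HX)].
    erewrite (pairing_scal al be Hab M b Hb) by eassumption.
    erewrite (pairing_scal al be Hab M b Hb) by eassumption.
    reflexivity. }
  assert (Hgb : Re (L g) <= (1 + 2 * t ^ 2) * V).
  { eapply norm_bound_scaled; eauto; [nra|].
    intros x Hx. unfold g, X.
    replace (p x + (RtoC t * w * q x + - (RtoC t * Cconj w) * (p x * p x * Cconj (q x))))%C
      with (p x + RtoC t * ((w * q x) - p x * p x * Cconj (w * q x)))%C
      by (rewrite Cmult_conj; ring).
    apply Cmod_perturbation; auto; [|lra].
    rewrite Cmod_mult, Hw1, Rmult_1_l. auto. }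
  rewrite Eg, <- Cmult_assoc, Hw2 in Hgb.
  assert (Hr : Re (RtoC t * Cconj w * L X) <= t * Cmod (L X)).
  { eapply Rle_trans; [apply Rle_abs|]. eapply Rle_trans; [apply re_le_Cmod|].
    rewrite !Cmod_mult, Cmod_conj, Hw1, Cmod_R, Rabs_pos_eq by lra. lra. }
  assert (HR : Re (L p) + t * Cmod (L q) - Re (RtoC t * Cconj w * L X) <= (1 + 2 * t ^ 2) * V).
  { eapply Rle_trans; [|exact Hgb]. simpl. right. ring. }
  apply Rmult_le_reg_l with t; [lra|].
  replace (t * (t * (1 + 2 * V) + Cmod (L X))) with ((1 + 2 * t ^ 2) * V - (V - t ^ 2) + t * Cmod (L X)) by ring.
  lra.
Qed.

(** One near-extremal p serves for all frequencies: with q = f e^{-imt}, the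
    conjugate in p^2 conj q turns e^{-imt} into e^{imt}. *)
Lemma decay_transfer V0 :
  norm_bound V0 ->
  (forall B f, test al be B f ->
     Clim (fun m => L (fun t => f t * e (Z.of_nat m) t)%C) (RtoC 0)) ->
  forall B f, test al be B f ->
     Clim (fun m => L (fun t => f t * e (- Z.of_nat m)%Z t)%C) (RtoC 0).
Proof.
  intros HV0 Hpos B f Hf.
  set (E := fun x => exists B f, test al be B f /\ unit_bounded f /\ x = Re (L f)).
  destruct (completeness E) as [V [Vub Vlub]].
  { exists V0. intros x (B' & g & Hg & Ug & ->). eapply HV0; eauto. }
  { exists (Re (L (fun _ => RtoC 0))). exists 0, (fun _ => RtoC 0).
    split; [apply test_0|split]; auto. intros t _. rewrite Cmod_0. lra. }
  assert (HV : norm_bound V).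
  { intros B' g Hg Ug. apply Vub. exists B', g. auto. }
  assert (HVn : forall eta, 0 < eta -> exists A p, test al be A p /\ unit_bounded p /\ V - eta <= Re (L p)).
  { intros eta He. apply NNPP. intros Hn.
    assert (V <= V - eta) as Hc; [|lra]. apply Vlub. intros x (A & p & Hp & Up & ->).
    apply Rnot_lt_le. intros Hlt. apply Hn. exists A, p. repeat split; auto. lra. }
  assert (HVpos : 0 <= V).
  { destruct (HVn 1 Rlt_0_1) as (A & p & Hp & Up & _).
    assert (E1 := HV _ _ Hp Up).
    assert (E2 := HV _ _ (test_scal al be A (RtoC (-1)) p Hp)).
    unfold L in E1, E2. rewrite (pairing_scal al be Hab M b Hb A) in E2 by auto.
    rewrite re_scal_l in E2. assert (U : unit_bounded (fun t => RtoC (-1) * p t)%C).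
    { intros t Ht. rewrite Cmod_mult, Cmod_R, Rabs_left by lra. specialize (Up t Ht). lra. }
    specialize (E2 U). lra. }
  assert (HB := test_B_nonneg al be Hab B f Hf).
  assert (Main : forall A g, test al be A g -> unit_bounded g ->
     Clim (fun m => L (fun t => g t * e (- Z.of_nat m)%Z t)%C) (RtoC 0)).
  { intros A g Hg Ug.
    assert (Hlim : is_lim_seq (fun m => Cmod (L (fun t => g t * e (- Z.of_nat m)%Z t)%C)) 0).
    { apply is_lim_seq_spec. intros [eps He]. simpl.
      set (t := Rmin (1 / 2) (eps / (2 * (1 + 2 * V)))).
      assert (Hd : 0 < eps / (2 * (1 + 2 * V))) by (apply Rdiv_lt_0_compat; lra).
      assert (Ht : 0 < t <= 1 / 2) by (unfold t; split; [apply Rmin_glb_lt; lra|apply Rmin_l]).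
      assert (Ht2 : t * (1 + 2 * V) <= eps / 2).
      { apply Rle_trans with (eps / (2 * (1 + 2 * V)) * (1 + 2 * V)).
        - apply Rmult_le_compat_r; [lra|apply Rmin_r].
        - right. field. lra. }
      destruct (HVn (t ^ 2)) as (P & p & Hp & Up & Hext); [nra|].
      assert (HX := test_mult al be _ _ _ _ (test_mult al be _ _ _ _ Hp (test_multiplier al be _ _ Hp))
                  (test_multiplier al be _ _ (test_conj al be _ _ Hg))).
      apply Hpos in HX. apply Clim_Cmod in HX. apply is_lim_seq_spec in HX.
      assert (He2 : 0 < eps / 2) by lra.
      destruct (HX (mkposreal _ He2)) as [N HN]. simpl in HN.
      exists N. intros m Hm. specialize (HN m Hm).
      rewrite Rminus_0_r, Rabs_pos_eq in HN by apply Cmod_ge_0.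
      rewrite Rminus_0_r, Rabs_pos_eq by apply Cmod_ge_0.
      assert (Hq := test_mult al be _ _ _ _ Hg (multiplier_e al be (- Z.of_nat m))).
      assert (Uq : unit_bounded (fun t => g t * e (- Z.of_nat m)%Z t)%C).
      { intros x Hx. rewrite Cmod_mult, Cmod_e, Rmult_1_r. auto. }
      eapply Rle_lt_trans; [apply (near_extremal_symmetry V t P _ p _ HV Ht Hp Up Hq Uq Hext)|].
      match type of HN with Cmod (?u - _) < _ =>
        match goal with |- _ + Cmod ?v < _ => replace v with u end end.
      - match type of HN with Cmod (?u - RtoC 0) < _ => replace (u - RtoC 0)%C with u in HN by ring end.
        lra.
      - unfold L. apply pairing_ext; auto. intros x _.
        rewrite Cmult_conj, e_conj, Z.opp_involutive. ring. }
    eapply Clim_of_Cmod; [exact Hlim|]. intros n. simpl. right. f_equal. ring. }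
  (* division by B + 1, as B may be 0, reduces to a test function bounded by 1 *)
  pose proof (test_scal al be B (RtoC (/ (B + 1))) f Hf) as Hg.
  assert (Ug : unit_bounded (fun t => RtoC (/ (B + 1)) * f t)%C).
  { intros t Ht. rewrite Cmod_mult, Cmod_R, Rabs_pos_eq by (left; apply Rinv_0_lt_compat; lra).
    pose proof (test_bound al be B f Hf t Ht).
    apply Rmult_le_reg_l with (B + 1); [lra|]. rewrite <- Rmult_assoc, Rinv_r by lra. lra. }
  assert (Hl := Main _ _ Hg Ug).
  assert (Hl2 := Clim_mult _ _ _ _ (Clim_const (RtoC (B + 1))) Hl).
  replace (RtoC 0) with (RtoC (B + 1) * RtoC 0)%C by ring.
  eapply Clim_ext_loc; [|exact Hl2]. exists 0%nat. intros m _. simpl.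
  assert (Hq := test_mult al be _ _ _ _ Hg (multiplier_e al be (- Z.of_nat m))).
  unfold L. rewrite <- (pairing_scal al be Hab M b Hb _ (RtoC (B + 1)) _ Hq).
  apply pairing_ext; auto. intros x _.
  rewrite !Cmult_assoc, <- RtoC_mult, Rinv_r by lra. ring.
Qed.
End Rajchman.

(** * The Cauchy kernel *)

Definition kernel (z : C) (t : R) : C := (/ (1 - z * e (-1) t))%C.

Lemma cder_inv f t df : cder f t df -> f t <> RtoC 0 ->
  cder (fun s => / f s)%C t (- df * / f t * / f t)%C.
Proof.
  intros [H1 H2] Hn.
  set (n := fun s => fst (f s) ^ 2 + snd (f s) ^ 2).
  assert (Hn0 : n t <> 0).
  { unfold n. intros E. apply Hn. apply C_ext; unfold Re, Im; simpl; nra. }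
  assert (Hd : is_derive n t (2 * (fst df * fst (f t) + snd df * snd (f t)))).
  { unfold n. apply (is_derive_ext (fun s => fst (f s) * fst (f s) + snd (f s) * snd (f s))).
    { intros; simpl; ring. }
    replace (2 * _) with ((fst df * fst (f t) + fst (f t) * fst df) +
      (snd df * snd (f t) + snd (f t) * snd df)) by ring.
    apply (is_derive_plus (V := R_NormedModule));
      [now apply (is_derive_Rmult (fun s => fst (f s)) (fun s => fst (f s)))
      |now apply (is_derive_Rmult (fun s => snd (f s)) (fun s => snd (f s)))]. }
  split.
  - assert (D := is_derive_div (fun s => fst (f s)) n t _ _ H1 Hd Hn0).
    apply (is_derive_ext (fun s => fst (f s) / n s)); [reflexivity|].
    evar_last; [exact D|]. unfold n in *; simpl in *; unfold Re. field; contradict Hn0; lra.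
  - assert (H2' : is_derive (fun s => - snd (f s)) t (- snd df))
      by exact (is_derive_opp (V := R_NormedModule) (fun s => snd (f s)) t _ H2).
    assert (D := is_derive_div (fun s => - snd (f s)) n t _ _ H2' Hd Hn0).
    apply (is_derive_ext (fun s => - snd (f s) / n s)); [reflexivity|].
    evar_last; [exact D|]. unfold n in *; simpl in *; unfold Im, Re; field; contradict Hn0; lra.
Qed.

Lemma Cmod_pos_neq0 (z : C) (k : R) : 0 < k -> k <= Cmod z -> z <> RtoC 0.
Proof. intros Hk H E. rewrite E, Cmod_0 in H. lra. Qed.

(** The derivative is a polynomial in the kernel itself because
    z e^{-it} K = K - 1. *)
Lemma cder_kernel z t : (1 - z * e (-1) t)%C <> RtoC 0 ->
  cder (kernel z) t (- Ci * (kernel z t * kernel z t - kernel z t))%C.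
Proof.
  intros H. unfold kernel.
  eapply cder_eq.
  - apply cder_inv; [|exact H].
    apply cder_plus; [apply cder_const|].
    apply (cder_eq _ _ (RtoC (-1) * (RtoC 0 * e (-1) t + z * (Ci * RtoC (IZR (-1)) * e (-1) t)))%C);
      [|reflexivity].
    assert (D := cder_mult (fun _ => RtoC (-1)) _ t _ _ (cder_const _ t)
       (cder_mult (fun _ => z) (e (-1)) t _ _ (cder_const z t) (cder_e (-1) t))).
    destruct D as [D1 D2]; split.
    + eapply is_derive_ext; [|evar_last; [exact D1|]]; [intros; simpl; ring|simpl; ring].
    + eapply is_derive_ext; [|evar_last; [exact D2|]]; [intros; simpl; ring|simpl; ring].
  - assert (E : RtoC (IZR (-1)) = (- RtoC 1)%C) by (apply C_ext; simpl; ring).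
    rewrite E. field. exact H.
Qed.

Lemma Cmod_kernel_le z t k : 0 < k -> k <= Cmod (1 - z * e (-1) t) ->
  Cmod (kernel z t) <= / k.
Proof.
  intros Hk H. unfold kernel. rewrite Cmod_inv by (eapply Cmod_pos_neq0; eauto).
  now apply Rinv_le_contravar.
Qed.

Lemma kernel_period z t : kernel z (t + 2 * PI) = kernel z t.
Proof. unfold kernel. now rewrite e_period. Qed.

(** |1 - z e^{-it}| is the distance from z to e^{it}; so z stays at distance at
    least k from the arc over [al, be]. *)
Definition off_arc (al be k : R) (z : C) : Prop :=
  forall t, al <= t <= be -> k <= Cmod (1 - z * e (-1) t).

Lemma multiplier_kernel al be k z : 0 < k <= 1 -> off_arc al be k z ->
  multiplier al be (6 * (/ k) ^ 3) (kernel z).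
Proof.
  intros Hk Hz.
  set (K1 := fun t => (- Ci * (kernel z t * kernel z t - kernel z t))%C).
  exists K1, (fun t => - Ci * ((RtoC 2 * kernel z t - RtoC 1) * K1 t))%C. split.
  2:{ intros ->. unfold K1. now rewrite kernel_period. }
  intros t Ht. specialize (Hz t Ht).
  assert (Hn := Cmod_pos_neq0 _ _ (proj1 Hk) Hz).
  assert (HK := Cmod_kernel_le z t k (proj1 Hk) Hz).
  assert (D := cder_kernel z t Hn). fold (K1 t) in D.
  assert (D1 : cder K1 t (- Ci * ((RtoC 2 * kernel z t - RtoC 1) * K1 t))%C).
  { eapply cder_eq.
    - apply (cder_mult (fun _ => (- Ci)%C)); [apply cder_const|].
      apply (cder_plus (fun s => kernel z s * kernel z s)%C (fun s => - kernel z s)%C t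
        (K1 t * kernel z t + kernel z t * K1 t)%C (- K1 t)%C).
      + now apply cder_mult.
      + destruct D as [A1 A2]; split; now apply (is_derive_opp (V := R_NormedModule)).
    - ring. }
  assert (HB : 1 <= / k) by (rewrite <- Rinv_1; apply Rinv_le_contravar; lra).
  set (B := / k) in *. assert (HP := Cmod_ge_0 (kernel z t)).
  assert (B1 : Cmod (K1 t) <= 2 * B ^ 2).
  { unfold K1, Cminus. rewrite Cmod_mult, Cmod_opp, Cmod_Ci, Rmult_1_l.
    eapply Rle_trans; [apply Cmod_triangle|]. rewrite Cmod_opp, Cmod_mult. nra. }
  assert (B2 : Cmod (RtoC 2 * kernel z t - RtoC 1) <= 3 * B).
  { unfold Cminus. eapply Rle_trans; [apply Cmod_triangle|].
    rewrite Cmod_opp, Cmod_mult, !Cmod_R, !Rabs_pos_eq by lra. lra. }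
  assert (HB2 : 1 <= B ^ 2) by nra.
  assert (HB3 : B ^ 2 <= B ^ 3) by (simpl in *; nra).
  split_C2.
  - exact D.
  - exact D1.
  - apply ccont_mult; [apply ccont_const|]. apply ccont_mult.
    + apply (ccont_plus (fun s => RtoC 2 * kernel z s)%C (fun _ => - RtoC 1)%C); [|apply ccont_const].
      apply ccont_mult; [apply ccont_const|exact (cder_ccont _ _ _ D)].
    + exact (cder_ccont _ _ _ D1).
  - assert (B <= B ^ 2) by nra. lra.
  - lra.
  - rewrite Cmod_mult, Cmod_opp, Cmod_Ci, Rmult_1_l, Cmod_mult.
    apply Rle_trans with ((3 * B) * (2 * B ^ 2)); [|right; ring].
    apply Rmult_le_compat; auto using Cmod_ge_0.
Qed.

(** * Complex differentiability *)

Lemma complex_differentiable_quadratic (f : C -> C) (z D : C) (A d : R) :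
  0 < d ->
  (forall w, Cmod (w - z) < d -> Cmod (f w - f z - (w - z) * D) <= A * Cmod (w - z) ^ 2) ->
  complex_differentiable f z.
Proof.
  intros Hd H. exists D. split.
  - apply is_linear_scal_l.
  - intros x Hx.
    assert (x = z) as ->.
    { symmetry. apply (is_filter_lim_locally_unique (K := C_AbsRing) (V := AbsRing_NormedModule C_AbsRing)). exact Hx. }
    intros eps.
    assert (HA : 0 < Rabs A + 1) by (pose proof (Rabs_pos A); lra).
    assert (Hr : 0 < Rmin d (eps / (Rabs A + 1))).
    { apply Rmin_glb_lt; auto. apply Rdiv_lt_0_compat; auto. apply cond_pos. }
    exists (mkposreal _ Hr). intros w Hw.
    change (Cmod (w - z) < Rmin d (eps / (Rabs A + 1))) in Hw.
    change (Cmod (f w - f z - (w - z) * D) <= eps * Cmod (w - z)).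
    assert (H1 := Rlt_le_trans _ _ _ Hw (Rmin_l _ _)).
    assert (H2 := Rlt_le_trans _ _ _ Hw (Rmin_r _ _)).
    eapply Rle_trans; [apply H; auto|].
    pose proof (Cmod_ge_0 (w - z)) as Hp.
    simpl. rewrite Rmult_1_r, <- Rmult_assoc. apply Rmult_le_compat_r; auto.
    apply Rle_trans with ((Rabs A + 1) * Cmod (w - z)).
    + apply Rmult_le_compat_r; auto. pose proof (Rle_abs A). lra.
    + apply Rle_trans with ((Rabs A + 1) * (eps / (Rabs A + 1))).
      * apply Rmult_le_compat_l; lra.
      * right. field. lra.
Qed.

Lemma complex_differentiable_near (f g : C -> C) (z : C) (d : R) :
  0 < d -> (forall w, Cmod (w - z) < d -> f w = g w) ->
  complex_differentiable f z -> complex_differentiable g z.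
Proof.
  intros Hd H [l Hl]. exists l. eapply is_derive_ext_loc; [|exact Hl].
  exists (mkposreal d Hd). intros w Hw. now apply H.
Qed.

Lemma complex_differentiable_scal (c : C) (f : C -> C) (z : C) :
  complex_differentiable f z -> complex_differentiable (fun w => c * f w)%C z.
Proof.
  intros [l [_ Hl]]. exists (c * l)%C. split; [apply is_linear_scal_l|].
  intros x Hx eps.
  assert (Hc : 0 < Cmod c + 1) by (pose proof (Cmod_ge_0 c); lra).
  assert (He : 0 < eps / (Cmod c + 1)) by (apply Rdiv_lt_0_compat; [apply cond_pos|auto]).
  specialize (Hl x Hx (mkposreal _ He)). revert Hl. apply filter_imp. intros w Hw.
  change (Cmod (f w - f x - (w - x) * l) <= eps / (Cmod c + 1) * Cmod (w - x)) in Hw.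
  change (Cmod (c * f w - c * f x - (w - x) * (c * l)) <= eps * Cmod (w - x)).
  replace (c * f w - c * f x - (w - x) * (c * l))%C with (c * (f w - f x - (w - x) * l))%C by ring.
  rewrite Cmod_mult.
  apply Rle_trans with ((Cmod c + 1) * (eps / (Cmod c + 1) * Cmod (w - x))).
  - pose proof (Cmod_ge_0 c). pose proof (Cmod_ge_0 (f w - f x - (w - x) * l)). nra.
  - right. field. lra.
Qed.

Lemma complex_differentiable_Clim (f : C -> C) (z : C) (u : nat -> C) :
  complex_differentiable f z -> Clim u z -> Clim (fun n => f (u n)) (f z).
Proof.
  intros Hf Hu.
  pose proof (ex_derive_continuous f z Hf) as Hc.
  apply Clim_Cmod in Hu.
  apply Clim_of_Cmod with (fun n => Cmod (f (u n) - f z)); [|intros; apply Rle_refl].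
  apply is_lim_seq_spec. intros eps. simpl.
  assert (Hball : locally (f z) (fun y : C_NormedModule => Cmod (y - f z) < eps)).
  { apply (locally_le_locally_norm (K := C_AbsRing) (V := C_NormedModule)).
    exists eps. intros y Hy. exact Hy. }
  specialize (Hc _ Hball). destruct Hc as [d Hd].
  apply is_lim_seq_spec in Hu. destruct (Hu d) as [N HN].
  exists N. intros n Hn. specialize (HN n Hn). simpl in HN.
  rewrite Rminus_0_r, Rabs_pos_eq in HN by apply Cmod_ge_0.
  rewrite Rminus_0_r, Rabs_pos_eq by apply Cmod_ge_0.
  apply (Hd (u n)). exact HN.
Qed.

Lemma off_arc_near al be k z w : off_arc al be k z -> Cmod (w - z) <= k / 2 ->
  off_arc al be (k / 2) w.
Proof.
  intros H Hw t Ht. specialize (H t Ht).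
  replace (1 - z * e (-1) t)%C with ((1 - w * e (-1) t) + (w - z) * e (-1) t)%C in H by ring.
  pose proof (Cmod_triangle (1 - w * e (-1) t) ((w - z) * e (-1) t)) as T.
  rewrite Cmod_mult, Cmod_e in T. lra.
Qed.

Lemma off_arc_weaken al be k k' z : k' <= k -> off_arc al be k z -> off_arc al be k' z.
Proof. intros Hk H t Ht. specialize (H t Ht). lra. Qed.

Lemma kernel_expansion z w t :
  (1 - z * e (-1) t)%C <> RtoC 0 -> (1 - w * e (-1) t)%C <> RtoC 0 ->
  kernel w t = (kernel z t + ((w - z) * (e (-1) t * (kernel z t * kernel z t))
    + (w - z) * (w - z) * (e (-1) t * e (-1) t * (kernel z t * kernel z t * kernel w t))))%C.
Proof. intros H1 H2. unfold kernel. field. auto. Qed.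

(** * Cauchy transforms *)

Definition cauchy_transform (b : Z -> C) (al be : R) (eta : R -> C) (z : C) : C :=
  pairing b al be (fun t => eta t * kernel z t)%C.

(** The second-order remainder of the kernel in z, times the test function, is a
    test function with a bound independent of the increment; so is its pairing with
    b, hence the transform has a quadratic remainder. *)
Lemma cauchy_differentiable al be M b B eta k z :
  al <= be -> zbounded M b -> test al be B eta -> 0 < k <= 1 -> off_arc al be k z ->
  complex_differentiable (cauchy_transform b al be eta) z.
Proof.
  intros Hab Hb Heta Hk Hz.
  assert (Hk2 : 0 < k / 2 <= 1) by lra.
  assert (Hz2 : off_arc al be (k / 2) z) by (eapply off_arc_weaken; [|exact Hz]; lra).
  assert (MK := multiplier_kernel al be (k / 2) z Hk2 Hz2).
  assert (ME := multiplier_e al be (-1)).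
  assert (MKK := multiplier_mult al be _ _ _ _ MK MK).
  assert (T1 := test_mult al be _ _ _ _ Heta (multiplier_mult al be _ _ _ _ ME MKK)).
  set (g1 := fun t => (eta t * (e (-1) t * (kernel z t * kernel z t)))%C) in *.
  set (A := 6 * (/ (k / 2)) ^ 3) in *.
  assert (T2 : exists B2, forall w, off_arc al be (k / 2) w ->
     test al be B2 (fun t => eta t * (e (-1) t * e (-1) t * (kernel z t * kernel z t * kernel w t)))%C).
  { eexists. intros w Hw.
    assert (MW := multiplier_kernel al be (k / 2) w Hk2 Hw). fold A in MW.
    exact (test_mult al be _ _ _ _ Heta (multiplier_mult al be _ _ _ _
             (multiplier_mult al be _ _ _ _ ME ME) (multiplier_mult al be _ _ _ _ MKK MW))). }
  destruct T2 as [B2 T2].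
  apply (complex_differentiable_quadratic _ z (pairing b al be g1)
    (Zsum_const * (M * (4 * ((be - al) * B2)))) (k / 2)); [lra|].
  intros w Hw.
  assert (Hw2 : off_arc al be (k / 2) w) by (apply off_arc_near with z; auto; lra).
  specialize (T2 w Hw2).
  set (g2 := fun t => (eta t * (e (-1) t * e (-1) t * (kernel z t * kernel z t * kernel w t)))%C) in *.
  assert (T0 := test_mult al be _ _ _ _ Heta MK).
  assert (S1 := test_scal al be _ (w - z)%C _ T1).
  assert (S2 := test_scal al be _ ((w - z) * (w - z))%C _ T2).
  assert (E : cauchy_transform b al be eta w =
    (cauchy_transform b al be eta z + ((w - z) * pairing b al be g1 + (w - z) * (w - z) * pairing b al be g2))%C).
  { unfold cauchy_transform at 1.
    rewrite (pairing_ext al be Hab b _ (fun t => (eta t * kernel z t +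
       ((w - z) * g1 t + (w - z) * (w - z) * g2 t))%C)).
    - rewrite (pairing_plus al be Hab M b Hb _ _ _ _ T0 (test_plus al be _ _ _ _ S1 S2)).
      rewrite (pairing_plus al be Hab M b Hb _ _ _ _ S1 S2).
      rewrite (pairing_scal al be Hab M b Hb _ _ _ T1).
      rewrite (pairing_scal al be Hab M b Hb _ _ _ T2). reflexivity.
    - intros t Ht. unfold g1, g2.
      rewrite (kernel_expansion z w t) at 1; [ring| |];
        (eapply (Cmod_pos_neq0 _ (k / 2)); [lra|]); [apply Hz2|apply Hw2]; lra. }
  rewrite E.
  match goal with |- Cmod ?x <= _ => replace x with ((w - z) * (w - z) * pairing b al be g2)%C by ring end.
  rewrite !Cmod_mult.
  pose proof (pairing_Cmod_le al be Hab M b Hb _ _ T2).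
  pose proof (Cmod_ge_0 (w - z)).
  rewrite Rmult_comm. simpl. rewrite Rmult_1_r. apply Rmult_le_compat_r; nra.
Qed.

(** * Fourier coefficients of the kernel over a period *)

Lemma test_one al : test al (al + 2 * PI) 1 (fun _ => RtoC 1).
Proof.
  exists (fun _ => RtoC 0), (fun _ => RtoC 0). split; auto.
  intros t _. rewrite Cmod_0, Cmod_1.
  split_C2; try apply cder_const; try apply ccont_const; lra.
Qed.

Lemma off_circle z t : Rabs (1 - Cmod z) <= Cmod (1 - z * e (-1) t).
Proof.
  assert (E : Cmod (z * e (-1) t) = Cmod z) by (rewrite Cmod_mult, Cmod_e; ring).
  rewrite <- E. set (v := (z * e (-1) t)%C).
  pose proof (Cmod_triangle (1 - v) v) as T1.
  replace (1 - v + v)%C with (RtoC 1) in T1 by ring.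
  pose proof (Cmod_triangle (1 - v) (- RtoC 1)) as T2.
  replace (1 - v + - RtoC 1)%C with (- v)%C in T2 by ring.
  rewrite !Cmod_opp, Cmod_1 in T2. rewrite Cmod_1 in T1.
  apply Rabs_le. lra.
Qed.

Lemma off_circle_arc al be z : Cmod z <> 1 ->
  exists k, 0 < k <= 1 /\ off_arc al be k z.
Proof.
  intros H. exists (Rmin 1 (Rabs (1 - Cmod z))).
  assert (0 < Rabs (1 - Cmod z)) by (apply Rabs_pos_lt; lra).
  split.
  - split; [apply Rmin_glb_lt; lra|apply Rmin_l].
  - intros t _. eapply Rle_trans; [apply Rmin_r|apply off_circle].
Qed.

Lemma CInt_e al k : k <> 0%Z -> CInt (e k) al (al + 2 * PI) = RtoC 0.
Proof.
  intros Hk. pose proof PI_RGT_0.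
  assert (Hx : IZR k <> 0) by (now apply not_0_IZR).
  rewrite (CInt_FTC (fun t => (- Ci * RtoC (/ IZR k)) * e k t)%C); [|lra| |].
  - rewrite e_period. ring.
  - intros t _. eapply cder_eq.
    + apply (cder_mult (fun _ => (- Ci * RtoC (/ IZR k))%C) (e k)); [apply cder_const|apply cder_e].
    + transitivity (- (Ci * Ci) * (RtoC (/ IZR k) * RtoC (IZR k)) * e k t)%C; [ring|].
      rewrite <- RtoC_mult, Rinv_l by auto.
      replace (Ci * Ci)%C with (- RtoC 1)%C by (apply C_ext; simpl; ring). ring.
  - intros t _. apply ccont_e.
Qed.

Lemma CInt_e_0 al : CInt (e 0) al (al + 2 * PI) = RtoC (2 * PI).
Proof.
  pose proof PI_RGT_0.
  rewrite (CInt_ext _ (fun _ => RtoC 1)); [|lra|intros; apply e_0].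
  apply C_ext; simpl; rewrite RInt_const; unfold scal; simpl; unfold mult; simpl; ring.
Qed.

Lemma geometric_zero (x r A : R) : 0 <= r < 1 -> 0 <= x -> (forall n, x <= r ^ n * A) -> x = 0.
Proof.
  intros Hr Hx H. apply Rle_antisym; auto.
  assert (L : is_lim_seq (fun n => r ^ n * A) (0 * A)).
  { apply is_lim_seq_mult'; [|apply is_lim_seq_const]. apply is_lim_seq_geom. now rewrite Rabs_pos_eq. }
  rewrite Rmult_0_l in L.
  apply (is_lim_seq_le (fun _ => x) _ x 0) in L; auto using is_lim_seq_const.
Qed.

(** The identity (1 - z e^{-it}) K = 1 is a two-term recursion for the Fourier
    coefficients of K.  They are bounded, and the recursion propagates geometrically
    from the far indices: this kills the negative ones inside the disk and the
    nonnegative ones outside, and the others follow from index 0. *)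
Section Kernel_Fourier.
Variables (al : R) (z : C) (Hz : Cmod z <> 1).
Let J := fourier al (al + 2 * PI) (kernel z).

Lemma kernel_nz t : (1 - z * e (-1) t)%C <> RtoC 0.
Proof.
  eapply Cmod_pos_neq0; [|apply off_circle]. apply Rabs_pos_lt. lra.
Qed.

Lemma kernel_ccont t : ccont (kernel z) t.
Proof. eapply cder_ccont, cder_kernel, kernel_nz. Qed.

Lemma kernel_fourier_rec k :
  J k = (z * J (k - 1)%Z + CInt (e k) al (al + 2 * PI))%C.
Proof.
  pose proof PI_RGT_0.
  unfold J, fourier. rewrite <- CInt_scal, <- CInt_plus; try lra.
  - apply CInt_ext; [lra|]. intros t _.
    replace (e k t) with (e (k - 1) t * e 1 t)%C by (rewrite <- e_add; f_equal; lia).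
    assert (E : (e 1 t * e (-1) t)%C = RtoC 1) by apply (e_neg 1).
    transitivity (kernel z t * (e (k - 1) t * e 1 t) * (1 - z * e (-1) t)
       + z * (kernel z t * e (k - 1) t) * (e 1 t * e (-1) t))%C; [ring|].
    rewrite E. unfold kernel. field. apply kernel_nz.
  - intros t _. apply ccont_mult; [apply ccont_const|].
    apply ccont_mult; [apply kernel_ccont|apply ccont_e].
  - intros t _. apply ccont_e.
  - intros t _. apply ccont_mult; [apply kernel_ccont|apply ccont_e].
Qed.

Lemma kernel_fourier_bounded : exists A, 0 <= A /\ forall k, Cmod (J k) <= A.
Proof.
  pose proof PI_RGT_0.
  assert (Hp : 0 < Rabs (1 - Cmod z)) by (apply Rabs_pos_lt; lra).
  exists (2 * ((al + 2 * PI - al) * / Rabs (1 - Cmod z))). split.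
  - apply Rmult_le_pos; [lra|]. apply Rmult_le_pos; [lra|]. left; now apply Rinv_0_lt_compat.
  - intros k. apply Cmod_fourier_le; [lra| |].
    + intros t _. apply kernel_ccont.
    + intros t _. apply Cmod_kernel_le; auto. apply off_circle.
Qed.

Lemma kernel_fourier_inside_neg k : Cmod z < 1 -> (k < 0)%Z -> J k = RtoC 0.
Proof.
  intros H1 Hk. destruct kernel_fourier_bounded as (A & HA & HJ).
  assert (P : forall n, J k = (z ^ n * J (k - Z.of_nat n)%Z)%C).
  { induction n.
    - rewrite Z.sub_0_r. simpl. ring.
    - rewrite IHn, (kernel_fourier_rec (k - Z.of_nat n)), CInt_e by lia.
      replace (k - Z.of_nat n - 1)%Z with (k - Z.of_nat (S n))%Z by lia.
      rewrite Cpow_S. ring. }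
  apply Cmod_eq_0. apply geometric_zero with (Cmod z) A; [split; auto using Cmod_ge_0|apply Cmod_ge_0|].
  - intros n. rewrite (P n), Cmod_mult, Cmod_pow.
    apply Rmult_le_compat_l; auto. apply pow_le, Cmod_ge_0.
Qed.

Lemma kernel_fourier_inside n : Cmod z < 1 ->
  J (Z.of_nat n) = (RtoC (2 * PI) * z ^ n)%C.
Proof.
  intros H1. induction n.
  - rewrite kernel_fourier_rec. simpl Z.of_nat. rewrite CInt_e_0.
    rewrite (kernel_fourier_inside_neg (0 - 1)) by (auto; lia). simpl. ring.
  - rewrite kernel_fourier_rec, CInt_e by lia.
    replace (Z.of_nat (S n) - 1)%Z with (Z.of_nat n) by lia. rewrite IHn, Cpow_S. ring.
Qed.

Lemma kernel_fourier_outside_nonneg k : 1 < Cmod z -> (0 <= k)%Z -> J k = RtoC 0.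
Proof.
  intros H1 Hk. destruct kernel_fourier_bounded as (A & HA & HJ).
  assert (Hz0 : z <> RtoC 0) by (apply Cmod_gt_0; lra).
  assert (P : forall n, J k = ((/ z) ^ n * J (k + Z.of_nat n)%Z)%C).
  { induction n.
    - rewrite Z.add_0_r. simpl. ring.
    - rewrite IHn, (kernel_fourier_rec (k + Z.of_nat (S n))), CInt_e by lia.
      replace (k + Z.of_nat (S n) - 1)%Z with (k + Z.of_nat n)%Z by lia.
      rewrite Cpow_S. field. auto. }
  apply Cmod_eq_0. apply geometric_zero with (/ Cmod z) A; [|apply Cmod_ge_0|].
  - split; [left; apply Rinv_0_lt_compat; lra|].
    rewrite <- Rinv_1. apply Rinv_lt_contravar; lra.
  - intros n. rewrite (P n), Cmod_mult, Cmod_pow, Cmod_inv by auto.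
    apply Rmult_le_compat_l; auto. apply pow_le. left; apply Rinv_0_lt_compat; lra.
Qed.

Lemma kernel_fourier_outside n : 1 < Cmod z ->
  J (- Z.of_nat (S n))%Z = (RtoC (- (2 * PI)) * / z ^ S n)%C.
Proof.
  intros H1. assert (Hz0 : z <> RtoC 0) by (apply Cmod_gt_0; lra).
  induction n.
  - assert (E := kernel_fourier_rec 0). rewrite CInt_e_0 in E.
    rewrite (kernel_fourier_outside_nonneg 0) in E by (auto; lia).
    simpl (0 - 1)%Z in E. simpl (- Z.of_nat 1)%Z. rewrite Cpow_1_r.
    transitivity (/ z * (z * J (-1)%Z + RtoC (2 * PI)) - / z * RtoC (2 * PI))%C.
    + field. auto.
    + rewrite <- E, RtoC_opp. ring.
  - assert (E := kernel_fourier_rec (- Z.of_nat (S n))). rewrite CInt_e in E by lia.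
    replace (- Z.of_nat (S n) - 1)%Z with (- Z.of_nat (S (S n)))%Z in E by lia.
    rewrite IHn in E.
    transitivity (/ z * (z * J (- Z.of_nat (S (S n)))%Z + 0))%C; [field; auto|].
    rewrite <- E, (Cpow_S z (S n)). field. split; auto. now apply Cpow_nz.
Qed.
End Kernel_Fourier.

Lemma CSeries_scal_R (r : R) u : CSeries (fun n => RtoC r * u n)%C = (RtoC r * CSeries u)%C.
Proof.
  apply C_ext; simpl; rewrite ?Rmult_0_l, ?Rminus_0_r, ?Rplus_0_r; rewrite <- Series_scal_l;
    apply Series_ext; intros; ring.
Qed.

Lemma CSeries_0 : CSeries (fun _ => RtoC 0) = RtoC 0.
Proof.
  rewrite (CSeries_ext _ (fun n => RtoC 0 * RtoC 0)%C) by (intros; ring).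
  rewrite CSeries_scal_R. ring.
Qed.

Definition full_cauchy (b : Z -> C) (al : R) : C -> C :=
  cauchy_transform b al (al + 2 * PI) (fun _ => RtoC 1).

Lemma full_cauchy_fourier b al z :
  full_cauchy b al z = Zsum (fun k => b k * fourier al (al + 2 * PI) (kernel z) k)%C.
Proof.
  pose proof PI_RGT_0.
  unfold full_cauchy, cauchy_transform, pairing. apply Zsum_ext. intros k. f_equal.
  unfold fourier. apply CInt_ext; [lra|]. intros; ring.
Qed.

Lemma full_cauchy_inside b al z : Cmod z < 1 ->
  full_cauchy b al z = (RtoC (2 * PI) * f_plus b z)%C.
Proof.
  intros Hz. rewrite full_cauchy_fourier. unfold Zsum, f_plus, power_series.
  rewrite <- (Cplus_0_r (RtoC (2 * PI) * _)%C), <- CSeries_0, <- CSeries_scal_R.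
  f_equal; apply CSeries_ext; intros n.
  - rewrite kernel_fourier_inside by lra. ring.
  - rewrite kernel_fourier_inside_neg; [ring|lra|auto|lia].
Qed.

Lemma full_cauchy_outside b al z : 1 < Cmod z ->
  full_cauchy b al z = (RtoC (- (2 * PI)) * f_minus b (Some z))%C.
Proof.
  intros Hz. rewrite full_cauchy_fourier. unfold Zsum, f_minus.
  rewrite <- (Cplus_0_l (RtoC (- (2 * PI)) * _)%C), <- CSeries_0, <- CSeries_scal_R.
  f_equal; apply CSeries_ext; intros n.
  - rewrite kernel_fourier_outside_nonneg; [ring|lra|auto|lia].
  - rewrite kernel_fourier_outside by lra. ring.
Qed.

Lemma full_cauchy_differentiable M b al z : zbounded M b -> Cmod z <> 1 ->
  complex_differentiable (full_cauchy b al) z.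
Proof.
  intros Hb Hz. pose proof PI_RGT_0.
  destruct (off_circle_arc al (al + 2 * PI) z Hz) as (k & Hk & Ho).
  apply (cauchy_differentiable al (al + 2 * PI) M b 1 _ k); auto; [lra|apply test_one].
Qed.

Lemma power_series_differentiable M a : (forall n, Cmod (a n) <= M) ->
  analytic_on_disk (power_series a).
Proof.
  intros Ha z Hz. pose proof PI_RGT_0.
  assert (Hd : 0 < 1 - Cmod z) by lra.
  apply (complex_differentiable_near (fun w => RtoC (/ (2 * PI)) * full_cauchy (extend0 a) 0 w)%C
           _ z _ Hd).
  - intros w Hw.
    assert (Hw1 : Cmod w < 1).
    { replace w with ((w - z) + z)%C by ring.
      eapply Rle_lt_trans; [apply Cmod_triangle|lra]. }
    rewrite full_cauchy_inside by auto.
    rewrite Cmult_assoc, <- RtoC_mult, Rinv_l, Cmult_1_l by lra.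
    apply CSeries_ext. intros n. f_equal. unfold extend0.
    destruct (Z.ltb_spec (Z.of_nat n) 0); [lia|]. now rewrite Nat2Z.id.
  - apply complex_differentiable_scal.
    apply (full_cauchy_differentiable M); [now apply zbounded_extend0|lra].
Qed.

(** * Bounded arc means force right limits to vanish on the arc *)

Fixpoint csum (u : nat -> C) (N : nat) : C :=
  match N with O => u O | S n => (csum u n + u (S n))%C end.

Lemma Clim_csum (d : nat -> R) (u : nat -> C) :
  ex_series d -> (forall n, Cmod (u n) <= d n) -> Clim (csum u) (CSeries u).
Proof.
  intros Hd Hu.
  pose proof (Series_correct _ (dominated_ex_Re d Hd u Hu)) as H1.
  pose proof (Series_correct _ (dominated_ex_Im d Hd u Hu)) as H2.
  split.
  - change (is_lim_seq (sum_n (fun n => fst (u n))) (Series (fun n => fst (u n)))) in H1.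
    eapply is_lim_seq_ext; [|exact H1]. induction n; [apply sum_O|].
    rewrite sum_Sn, IHn. reflexivity.
  - change (is_lim_seq (sum_n (fun n => snd (u n))) (Series (fun n => snd (u n)))) in H2.
    eapply is_lim_seq_ext; [|exact H2]. induction n; [apply sum_O|].
    rewrite sum_Sn, IHn. reflexivity.
Qed.

Lemma CSeries_split (d : nat -> R) (u : nat -> C) (N : nat) :
  ex_series d -> (forall n, Cmod (u n) <= d n) ->
  CSeries u = (csum u N + CSeries (fun k => u (S N + k)%nat))%C.
Proof.
  intros Hd Hu. induction N.
  - simpl. now apply (CSeries_incr_1 d).
  - rewrite IHN.
    rewrite (CSeries_incr_1 (fun k => d (S N + k)%nat) (proj1 (ex_series_incr_n d (S N)) Hd)
               (fun k => u (S N + k)%nat)) by (intros; apply Hu).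
    simpl csum. rewrite Nat.add_0_r, Cplus_assoc. f_equal.
    apply CSeries_ext; intros. f_equal; lia.
Qed.

Lemma power_series_tail (a : nat -> C) M (r : R) (z : C) N :
  (forall n, Cmod (a n) <= M) -> 0 <= r < 1 -> Cmod z = r ->
  Cmod (csum (fun n => a n * z ^ n)%C N)
   <= Cmod (power_series a z) + 2 * (M * / (1 - r)) * r ^ S N.
Proof.
  intros Ha Hr Hz.
  assert (HM : 0 <= M) by (eapply Rle_trans; [apply Cmod_ge_0|apply (Ha 0%nat)]).
  assert (Hg : ex_series (fun n => r ^ n)) by (apply ex_series_geom; now rewrite Rabs_pos_eq).
  assert (Hd : forall c, ex_series (fun n => c * r ^ n))
    by (intros c; apply (ex_series_scal (V := R_NormedModule)); exact Hg).
  assert (Hb : forall n, Cmod (a n * z ^ n) <= M * r ^ n).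
  { intros n. rewrite Cmod_mult, Cmod_pow, Hz. apply Rmult_le_compat_r; auto. now apply pow_le. }
  unfold power_series.
  pose proof (CSeries_split _ _ N (Hd M) Hb) as E.
  set (T := CSeries (fun k => (a (S N + k)%nat * z ^ (S N + k))%C)) in *.
  assert (HT : Cmod T <= 2 * (M * / (1 - r)) * r ^ S N).
  { replace (2 * (M * / (1 - r)) * r ^ S N) with (2 * Series (fun k => M * r ^ S N * r ^ k)).
    - apply CSeries_Cmod_le; auto. intros n.
      eapply Rle_trans; [apply Hb|]. rewrite pow_add. right; ring.
    - rewrite (Series_scal_l (M * r ^ S N) (fun k => r ^ k)), Series_geom; [ring|].
      rewrite Rabs_pos_eq; lra. }
  replace (csum (fun n => (a n * z ^ n)%C) N) with (CSeries (fun n => (a n * z ^ n)%C) + - T)%C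
    by (rewrite E; ring).
  eapply Rle_trans; [apply Cmod_triangle|]. rewrite Cmod_opp. lra.
Qed.

Lemma CInt_mult_csum al be B g (c : nat -> C) N :
  al <= be -> test al be B g ->
  csum (fun n => c n * fourier al be g (Z.of_nat n))%C N =
  CInt (fun t => g t * csum (fun n => c n * e (Z.of_nat n) t) N)%C al be /\
  ccont_on al be (fun t => g t * csum (fun n => c n * e (Z.of_nat n) t) N)%C.
Proof.
  intros Hab Hg. assert (Hc := test_ccont al be B g Hg).
  assert (T : forall n, ccont_on al be (fun t => c n * (g t * e (Z.of_nat n) t))%C).
  { intros n t Ht. apply ccont_mult; [apply ccont_const|].
    apply ccont_mult; [now apply Hc|apply ccont_e]. }
  assert (S1 : forall n, (c n * fourier al be g (Z.of_nat n))%C =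
     CInt (fun t => c n * (g t * e (Z.of_nat n) t))%C al be).
  { intros n. unfold fourier. rewrite CInt_scal; auto. now apply ccont_on_mult_e. }
  assert (W : forall f h, (forall t, f t = h t) -> ccont_on al be f -> ccont_on al be h).
  { intros f h E H t Ht. destruct (H t Ht) as [H1 H2].
    split; [eapply continuous_ext; [|exact H1]|eapply continuous_ext; [|exact H2]];
      intros; cbv beta; now rewrite E. }
  induction N; simpl.
  - split.
    + rewrite S1. apply CInt_ext; auto. intros; simpl (Z.of_nat 0); ring.
    + eapply W; [|apply (T 0%nat)]. intros; simpl; ring.
  - destruct IHN as [E Hcc]. split.
    + rewrite E, S1, <- CInt_plus; auto. apply CInt_ext; auto. intros; simpl; ring.
    + eapply W; [|intros t Ht; exact (ccont_plus _ _ t (Hcc t Ht) (T (S N) t Ht))].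
      intros; simpl; ring.
Qed.

Lemma pairing_extend0 (c : nat -> C) al be f :
  pairing (extend0 c) al be f = CSeries (fun n => c n * fourier al be f (Z.of_nat n))%C.
Proof.
  unfold pairing, Zsum. rewrite <- (Cplus_0_r (CSeries (fun n => c n * _)%C)), <- CSeries_0.
  f_equal; apply CSeries_ext; intros n; unfold extend0.
  - destruct (Z.ltb_spec (Z.of_nat n) 0); [lia|]. now rewrite Nat2Z.id.
  - destruct (Z.ltb_spec (- Z.of_nat (S n)) 0); [|lia]. ring.
Qed.

Definition radius (j : nat) : R := 1 - / (INR j + 2).

Lemma is_lim_radius : is_lim_seq radius 1.
Proof.
  replace (Finite 1) with (Finite (1 - 0)) by (f_equal; ring).
  apply is_lim_seq_minus'; [apply is_lim_seq_const|].
  apply is_lim_inv_INR_add_2.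
Qed.

Lemma radius_bounds j : 0 < radius j < 1.
Proof.
  unfold radius.
  pose proof (pos_INR j).
  assert (0 < / (INR j + 2)) by (apply Rinv_0_lt_compat; lra).
  assert (/ (INR j + 2) < / 1) by (apply Rinv_lt_contravar; lra). lra.
Qed.

Section Arc_bound.
Variables (a : nat -> C) (M : R) (Ha : forall n, Cmod (a n) <= M).
Variables (I : open_arc) (A : R).
Hypothesis HA : forall r, 0 < r < 1 -> arc_mean (power_series a) I r <= A.

Let Hab : lo I <= hi I := Rlt_le _ _ (lo_lt_hi I).

Lemma circle_continuous r t : 0 < r < 1 ->
  ccont (fun s => power_series a (RtoC r * (cos s, sin s))%C) t.
Proof.
  intros Hr.
  set (z := (RtoC r * (cos t, sin t))%C).
  assert (Hz : Cmod z < 1).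
  { unfold z. rewrite Cmod_mult, Cmod_unit, Cmod_R, Rabs_pos_eq; lra. }
  assert (Hc := ex_derive_continuous _ _ (power_series_differentiable M a Ha z Hz)).
  assert (Hp : filterlim (fun s => (RtoC r * (cos s, sin s))%C) (locally t)
                 (@locally (AbsRing_UniformSpace C_AbsRing) z)).
  { intros P [d Hd].
    assert (Hcont : continuous (fun s => Cmod (RtoC r * (cos s, sin s) - z)) t).
    { apply (ccont_Cmod (fun s => (RtoC r * (cos s, sin s) + - z)%C)).
      apply ccont_plus; [|apply ccont_const]. apply ccont_mult; [apply ccont_const|].
      split; simpl; [apply continuous_cos|apply continuous_sin]. }
    assert (H0 : Cmod (RtoC r * (cos t, sin t) - z) < d).
    { replace (RtoC r * (cos t, sin t) - z)%C with (RtoC 0) by (unfold z; ring).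
      rewrite Cmod_0. apply cond_pos. }
    assert (L : locally t (fun s => Cmod (RtoC r * (cos s, sin s) - z) < d)).
    { apply (Hcont (fun y => y < d)). apply (open_lt d). exact H0. }
    unfold filtermap. revert L. apply filter_imp. intros s Hs. apply Hd. exact Hs. }
  assert (Hf := filterlim_comp _ _ _ _ _ _ _ _ Hp Hc).
  split.
  - apply (filterlim_comp _ _ _ _ (fun y : C => fst y) _ _ _ Hf).
    apply (continuous_fst (U := R_UniformSpace) (V := R_UniformSpace)).
  - apply (filterlim_comp _ _ _ _ (fun y : C => snd y) _ _ _ Hf).
    apply (continuous_snd (U := R_UniformSpace) (V := R_UniformSpace)).
Qed.

(** The partial sums of the pairing are integrals of g against partial sums of the
    power series at radius r, whose mean over the arc exceeds that of f by a
    geometrically small error. *)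
Lemma pairing_abel_bound B g r :
  test (lo I) (hi I) B g -> unit_bounded (lo I) (hi I) g -> 0 < r < 1 ->
  Cmod (pairing (extend0 (fun n => a n * RtoC (r ^ n))%C) (lo I) (hi I) g) <= 4 * PI * A.
Proof.
  intros Hg Ug Hr. pose proof PI_RGT_0.
  set (c := fun n => (a n * RtoC (r ^ n))%C).
  set (F := fun t => power_series a (RtoC r * (cos t, sin t))%C).
  assert (Hr' : 0 <= r < 1) by lra.
  assert (Hc : forall n, Cmod (c n) <= M).
  { intros n. unfold c. rewrite Cmod_mult, Cmod_R, Rabs_pos_eq by (apply pow_le; lra).
    assert (r ^ n <= 1) by (rewrite <- (pow1 n); apply pow_incr; lra).
    pose proof (Cmod_ge_0 (a n)). pose proof (pow_le r n (proj1 Hr')). specialize (Ha n). nra. }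
  rewrite pairing_extend0.
  assert (Hdom := pairing_dominated _ _ Hab M _ (zbounded_extend0 M c Hc) B g Hg).
  assert (HL : Clim (csum (fun n => c n * fourier (lo I) (hi I) g (Z.of_nat n))%C)
                 (CSeries (fun n => c n * fourier (lo I) (hi I) g (Z.of_nat n))%C)).
  { eapply Clim_csum; [|intros n; eapply Rle_trans;
      [|apply (quad_dominated_pos_half _ _ Hdom n)]].
    - apply ex_series_scal_weight.
    - right. unfold extend0. destruct (Z.ltb_spec (Z.of_nat n) 0); [lia|]. now rewrite Nat2Z.id. }
  set (l := CSeries _) in *.
  assert (HFc : ex_RInt (fun t => Cmod (F t)) (lo I) (hi I)).
  { apply ex_RInt_on; auto. intros t Ht. apply ccont_Cmod. now apply circle_continuous. }
  assert (HF : RInt (fun t => Cmod (F t)) (lo I) (hi I) <= 2 * PI * A).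
  { specialize (HA r Hr). unfold arc_mean in HA. fold F in HA.
    rewrite (RInt_ext _ (fun t => / (2 * PI) * Cmod (F t))) in HA
      by (intros; unfold Rdiv; apply Rmult_comm).
    rewrite (RInt_scal (V := R_CompleteNormedModule) (fun t => Cmod (F t)) _ _ (/ (2 * PI))) in HA by auto.
    unfold scal in HA; simpl in HA; unfold mult in HA; simpl in HA.
    apply Rmult_le_reg_l with (/ (2 * PI)); [apply Rinv_0_lt_compat; lra|].
    eapply Rle_trans; [exact HA|]. right. field. lra. }
  assert (HN : forall N, Cmod (csum (fun n => c n * fourier (lo I) (hi I) g (Z.of_nat n))%C N)
      <= 4 * PI * A + 2 * ((hi I - lo I) * (2 * (M * / (1 - r)) * r ^ S N))).
  { intros N. destruct (CInt_mult_csum _ _ B g c N Hab Hg) as [-> Hcc].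
    set (tl := 2 * (M * / (1 - r)) * r ^ S N).
    assert (Hex : ex_RInt (fun t => Cmod (F t) + tl) (lo I) (hi I)).
    { apply (ex_RInt_plus (V := R_NormedModule)); auto. apply ex_RInt_const. }
    eapply Rle_trans; [apply (CInt_Cmod_le _ (fun t => Cmod (F t) + tl)); auto|].
    - intros t Ht. rewrite Cmod_mult.
      assert (HS : Cmod (csum (fun n => c n * e (Z.of_nat n) t)%C N) <= Cmod (F t) + tl).
      { assert (Hz : Cmod (RtoC r * (cos t, sin t)) = r).
        { rewrite Cmod_mult, Cmod_unit, Cmod_R, Rabs_pos_eq; lra. }
        pose proof (power_series_tail a M r _ N Ha Hr' Hz) as Ht'. fold tl in Ht'. fold (F t) in Ht'.
        replace (csum (fun n => (c n * e (Z.of_nat n) t)%C) N)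
          with (csum (fun n => (a n * (RtoC r * (cos t, sin t)) ^ n)%C) N); auto.
        clear. assert (Q : forall u v, (forall n, u n = v n) -> csum u N = csum v N).
        { intros u v E. induction N; simpl; congruence. }
        apply Q. intros n. unfold c. rewrite Cpow_mult_l, e_pow, RtoC_pow. ring. }
      pose proof (Cmod_ge_0 (csum (fun n => (c n * e (Z.of_nat n) t)%C) N)).
      specialize (Ug t Ht). pose proof (Cmod_ge_0 (g t)). nra.
    - rewrite (RInt_plus (V := R_CompleteNormedModule)); auto using ex_RInt_const.
      rewrite RInt_const. unfold plus, scal; simpl; unfold mult; simpl. lra. }
  apply Clim_Cmod in HL.
  assert (HR : is_lim_seq (fun N => Cmod (csum (fun n => c n * fourier (lo I) (hi I) g (Z.of_nat n))%C N - l)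
     + (4 * PI * A + (4 * ((hi I - lo I) * (M * / (1 - r)) * r)) * r ^ N)) (0 + (4 * PI * A + (4 * ((hi I - lo I) * (M * / (1 - r)) * r)) * 0))).
  { apply is_lim_seq_plus'; auto. apply is_lim_seq_plus'; [apply is_lim_seq_const|].
    apply is_lim_seq_mult'; [apply is_lim_seq_const|]. apply is_lim_seq_geom. now rewrite Rabs_pos_eq. }
  rewrite Rplus_0_l, Rmult_0_r, Rplus_0_r in HR.
  apply (is_lim_seq_le (fun _ => Cmod l) _ (Cmod l) (4 * PI * A)) in HR; auto using is_lim_seq_const.
  intros N. specialize (HN N).
  set (s := csum _ N) in *.
  replace l with (s + - (s - l))%C at 1 by ring.
  eapply Rle_trans; [apply Cmod_triangle|]. rewrite Cmod_opp. simpl in HN. lra.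
Qed.

(** Abel summation: the bound at radius r passes to the limit r -> 1.  In 4 PI A, one
    factor 2 comes from estimating componentwise and 2 PI from the normalization of
    the arc mean. *)
Lemma arc_norm_bound : norm_bound (lo I) (hi I) (extend0 a) (4 * PI * A).
Proof.
  intros B g Hg Ug.
  assert (HL : Clim (fun j => pairing (extend0 (fun n => a n * RtoC (radius j ^ n))%C) (lo I) (hi I) g)
                    (pairing (extend0 a) (lo I) (hi I) g)).
  { apply pairing_lim with M B; auto.
    - intros j. apply zbounded_extend0. intros n.
      assert (H := radius_bounds j).
      rewrite Cmod_mult, Cmod_R, Rabs_pos_eq by (apply pow_le; lra).
      assert (radius j ^ n <= 1) by (rewrite <- (pow1 n); apply pow_incr; lra).
      pose proof (Cmod_ge_0 (a n)). assert (0 <= radius j ^ n) by (apply pow_le; lra).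
      specialize (Ha n). nra.
    - intros k. unfold extend0. destruct (k <? 0)%Z; [apply Clim_const|].
      replace (a (Z.to_nat k)) with (a (Z.to_nat k) * RtoC 1)%C at 1 by ring.
      apply Clim_mult; [apply Clim_const|].
      split; simpl; [|apply is_lim_seq_const].
      induction (Z.to_nat k); simpl; [apply is_lim_seq_const|].
      replace (Finite 1) with (Finite (1 * 1)) by (f_equal; ring).
      apply is_lim_seq_mult'; [apply is_lim_radius|apply IHn]. }
  destruct HL as [HL _].
  apply (is_lim_seq_le _ (fun _ => 4 * PI * A) _ (4 * PI * A)) in HL; auto using is_lim_seq_const.
  intros j. eapply Rle_trans; [apply Rle_abs|]. eapply Rle_trans; [apply re_le_Cmod|].
  apply pairing_abel_bound with B; auto. apply radius_bounds.
Qed.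

Lemma right_limit_bounded b : right_limit a b -> zbounded M b.
Proof.
  intros (nj & _ & Hb) k. specialize (Hb k). apply filterlim_Clim in Hb.
  apply Clim_Cmod in Hb.
  set (u := fun j => a (Z.to_nat (k + nj j))) in *.
  assert (HL : is_lim_seq (fun j => M + Cmod (u j - b k)) (M + 0)).
  { apply is_lim_seq_plus'; auto. apply is_lim_seq_const. }
  rewrite Rplus_0_r in HL.
  apply (is_lim_seq_le (fun _ => Cmod (b k)) _ (Cmod (b k)) M) in HL; auto using is_lim_seq_const.
  intros j. replace (b k) with (u j + - (u j - b k))%C at 1 by ring.
  eapply Rle_trans; [apply Cmod_triangle|]. rewrite Cmod_opp.
  specialize (Ha (Z.to_nat (k + nj j))). unfold u at 1. lra.
Qed.

(** Along the integers n_j, pairing with e^{-i n_j t} translates the sequence a to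
    one that converges to b; the same quantities tend to 0 by [decay_transfer]. *)
Theorem right_limit_pairing_vanishes b B g :
  right_limit a b -> test (lo I) (hi I) B g -> pairing b (lo I) (hi I) g = RtoC 0.
Proof.
  intros (nj & Hinf & Hb) Hg.
  assert (Hz := zbounded_extend0 M a Ha).
  assert (Hdec := decay_transfer _ _ Hab M _ Hz _ arc_norm_bound
    (fun B f Hf => pairing_extend0_e_pos _ _ M a B f Hab Ha Hf) B g Hg).
  set (m := fun j => Z.to_nat (nj j)).
  assert (L1 : Clim (fun j => pairing (extend0 a) (lo I) (hi I) (fun t => g t * e (- Z.of_nat (m j))%Z t)%C) (RtoC 0)).
  { assert (Hm : filterlim m eventually eventually).
    { intros P [N HN]. destruct (Hinf (Z.of_nat N)) as [J HJ]. exists J. intros j Hj.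
      apply HN. specialize (HJ j Hj). unfold m. lia. }
    destruct Hdec as [D1 D2]. split.
    - exact (filterlim_comp _ _ _ m _ _ _ _ Hm D1).
    - exact (filterlim_comp _ _ _ m _ _ _ _ Hm D2). }
  apply (Clim_unique (fun j => pairing (extend0 a) (lo I) (hi I) (fun t => g t * e (- Z.of_nat (m j))%Z t)%C)); auto.
  apply (Clim_ext_loc (fun j => pairing (fun k => extend0 a (k + Z.of_nat (m j))%Z) (lo I) (hi I) g)).
  { exists 0%nat. intros j _. symmetry. eapply pairing_e_neg; eauto. }
  apply pairing_lim with M B; auto; [intros j k; apply Hz|].
  intros k. specialize (Hb k). apply filterlim_Clim in Hb.
  eapply Clim_ext_loc; [|exact Hb].
  destruct (Hinf (Z.max 0 (- k))) as [J HJ]. exists J. intros j Hj. specialize (HJ j Hj).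
  unfold extend0, m. destruct (Z.ltb_spec (k + Z.of_nat (Z.to_nat (nj j))) 0); [lia|].
  do 2 f_equal. lia.
Qed.
End Arc_bound.

(** * A C^2 cutoff *)

Definition pos_pow (n : nat) (x : R) : R := Rmax 0 x ^ n.

Lemma pos_pow_nonpos n x : x <= 0 -> pos_pow (S n) x = 0.
Proof. intros H. unfold pos_pow. rewrite Rmax_left by lra. simpl; ring. Qed.

Lemma pos_pow_nonneg n x : 0 <= x -> pos_pow n x = x ^ n.
Proof. intros H. unfold pos_pow. now rewrite Rmax_right. Qed.

Lemma pos_pow_bound n x X : Rabs x <= X -> Rabs (pos_pow n x) <= X ^ n.
Proof.
  intros H. unfold pos_pow. rewrite <- RPow_abs. apply pow_incr.
  split; [apply Rabs_pos|]. pose proof (Rabs_pos x). pose proof (Rle_abs x).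
  rewrite Rabs_pos_eq by apply Rmax_l. apply Rmax_lub; lra.
Qed.

Lemma is_derive_pos_pow n x :
  is_derive (pos_pow (S (S n))) x (INR (S (S n)) * pos_pow (S n) x).
Proof.
  destruct (Rtotal_order x 0) as [H|[->|H]].
  - rewrite pos_pow_nonpos, Rmult_0_r by lra.
    apply (is_derive_ext_loc (fun _ => 0)); [|apply (is_derive_const (V := R_NormedModule))].
    apply (filter_imp (fun y => y < 0)); [|now apply (open_lt 0)].
    intros y Hy. rewrite pos_pow_nonpos; lra.
  - rewrite (pos_pow_nonpos n 0), Rmult_0_r by lra.
    apply is_derive_Reals. intros eps He.
    assert (Hd : 0 < Rmin 1 eps) by (apply Rmin_glb_lt; lra).
    exists (mkposreal _ Hd). intros h Hh0 Hh. simpl in Hh.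
    pose proof (Rmin_l 1 eps). pose proof (Rmin_r 1 eps).
    rewrite Rplus_0_l, (pos_pow_nonpos (S n) 0) by lra.
    replace ((pos_pow (S (S n)) h - 0) / h - 0) with (pos_pow (S (S n)) h / h) by (field; auto).
    unfold Rdiv. rewrite Rabs_mult, Rabs_inv.
    assert (Hp : 0 < Rabs h) by now apply Rabs_pos_lt.
    apply Rle_lt_trans with (Rabs h ^ (S (S n)) * / Rabs h).
    + apply Rmult_le_compat_r; [left; now apply Rinv_0_lt_compat|].
      apply pos_pow_bound; lra.
    + replace (Rabs h ^ S (S n) * / Rabs h) with (Rabs h ^ n * Rabs h) by (simpl; field; lra).
      assert (Rabs h ^ n <= 1) by (rewrite <- (pow1 n); apply pow_incr; lra).
      assert (0 <= Rabs h ^ n) by (apply pow_le; lra). nra.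
  - rewrite pos_pow_nonneg by lra.
    apply (is_derive_ext_loc (fun y => y ^ S (S n))).
    + apply (filter_imp (fun y => 0 < y)); [|now apply (open_gt 0)].
      intros y Hy. rewrite pos_pow_nonneg; lra.
    + evar_last; [apply is_derive_pow, is_derive_id|]. simpl pred. unfold one; simpl. ring.
Qed.

Lemma continuous_pos_pow_1 x : continuous (pos_pow 1) x.
Proof.
  apply (continuous_ext (fun y => (y + Rabs y) / 2)).
  - intros y. unfold pos_pow, Rmax. rewrite pow_1.
    destruct (Rle_dec 0 y); [rewrite Rabs_pos_eq|rewrite Rabs_left]; lra.
  - apply (continuous_Rmult (fun y => y + Rabs y) (fun _ => / 2)); [|apply continuous_const].
    apply continuous_Rplus; [apply continuous_id|apply continuous_Rabs].
Qed.

(** For n = 3 this third difference of the truncated power x_+^n, divided by 3!, is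
    a C^2 step: 0 for x <= 0 and, as the third difference of x^3 is the constant
    3!, 1 for x >= 3.  The cases n = 2 and n = 1 give its derivatives. *)
Definition third_diff (n : nat) (x : R) : R :=
  pos_pow n x - 3 * pos_pow n (x - 1) + 3 * pos_pow n (x - 2) - pos_pow n (x - 3).

Lemma third_diff_nonpos n x : x <= 0 -> third_diff (S n) x = 0.
Proof. intros H. unfold third_diff. rewrite !pos_pow_nonpos by lra. ring. Qed.

Lemma third_diff_bound n x X : Rabs x <= X -> Rabs (third_diff n x) <= 8 * (X + 3) ^ n.
Proof.
  intros H. unfold third_diff.
  assert (B : forall j, 0 <= j <= 3 -> Rabs (pos_pow n (x - j)) <= (X + 3) ^ n).
  { intros j Hj. apply pos_pow_bound. apply Rabs_le. apply Rabs_le_between in H. lra. }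
  assert (B0 := B 0). rewrite Rminus_0_r in B0.
  assert (B1 := B 1). assert (B2 := B 2). assert (B3 := B 3).
  specialize (B0 ltac:(lra)). specialize (B1 ltac:(lra)).
  specialize (B2 ltac:(lra)). specialize (B3 ltac:(lra)).
  apply Rabs_le_between in B0, B1, B2, B3. apply Rabs_le. lra.
Qed.

Lemma is_derive_third_diff n x :
  is_derive (third_diff (S (S n))) x (INR (S (S n)) * third_diff (S n) x).
Proof.
  assert (T : forall j, is_derive (fun y => pos_pow (S (S n)) (y - j)) x
                (INR (S (S n)) * pos_pow (S n) (x - j))).
  { intros j.
    evar_last.
    - apply (is_derive_comp (pos_pow (S (S n))) (fun y => y - j)).
      + apply is_derive_pos_pow.
      + evar_last; [apply (is_derive_minus (V := R_NormedModule) (fun y => y) (fun _ => j));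
          [apply is_derive_id|apply is_derive_const]|reflexivity].
    - unfold scal, minus, plus, opp, zero, one; simpl. unfold mult; simpl. ring. }
  unfold third_diff.
  replace (INR (S (S n)) * _) with
    (INR (S (S n)) * pos_pow (S n) x - 3 * (INR (S (S n)) * pos_pow (S n) (x - 1))
     + 3 * (INR (S (S n)) * pos_pow (S n) (x - 2)) - INR (S (S n)) * pos_pow (S n) (x - 3)) by ring.
  apply (is_derive_minus (V := R_NormedModule)); [|apply T].
  apply (is_derive_plus (V := R_NormedModule)).
  - apply (is_derive_minus (V := R_NormedModule)); [apply is_derive_pos_pow|].
    apply (is_derive_scal (fun y => pos_pow (S (S n)) (y - 1))), T.
  - apply (is_derive_scal (fun y => pos_pow (S (S n)) (y - 2))), T.
Qed.

Lemma continuous_third_diff_1 x : continuous (third_diff 1) x.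
Proof.
  assert (T : forall j, continuous (fun y => pos_pow 1 (y - j)) x).
  { intros j. apply (continuous_comp (fun y => y - j) (pos_pow 1)); [|apply continuous_pos_pow_1].
    apply continuous_Rminus; [apply continuous_id|apply continuous_const]. }
  unfold third_diff.
  apply continuous_Rminus; [|apply T]. apply continuous_Rplus.
  - apply continuous_Rminus; [apply continuous_pos_pow_1|].
    apply continuous_Rmult; [apply continuous_const|apply T].
  - apply continuous_Rmult; [apply continuous_const|apply T].
Qed.

Definition step (x : R) : R := third_diff 3 x / 6.

Lemma step_ge_3 x : 3 <= x -> step x = 1 /\ third_diff 2 x = 0.
Proof.
  intros H. unfold step, third_diff. rewrite !pos_pow_nonneg by lra. split; field.
Qed.

(** Composing the step with an affine function of cos(t - t0) makes the cutoff
    2pi-periodic, equal to 1 near t0 and supported near t0 modulo 2pi. *)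
Section Bump.
Variables (t0 lam c : R) (Hlam : 0 <= lam) (Hc : Rabs c <= 1).

Definition level (t : R) : R := lam * (cos (t - t0) - c).
Definition bump (t : R) : R := step (level t).

Lemma is_derive_level t : is_derive level t (- lam * sin (t - t0)).
Proof. unfold level. auto_derive; auto. unfold Rminus. ring. Qed.

Lemma C2_bump : exists B b1 b2,
  (forall al be, C2 al be B (fun t => RtoC (bump t)) b1 b2) /\
  (forall t, level t <= 0 -> bump t = 0 /\ b1 t = RtoC 0) /\
  (forall t, 3 <= level t -> bump t = 1 /\ b1 t = RtoC 0).
Proof.
  set (u1 := fun t => - lam * sin (t - t0)).
  set (u2 := fun t => - lam * cos (t - t0)).
  set (d1 := fun t => third_diff 2 (level t) / 2 * u1 t).
  set (d2 := fun t => third_diff 1 (level t) * u1 t * u1 t + third_diff 2 (level t) / 2 * u2 t).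
  set (X := 2 * lam + 3).
  set (B := 8 * X ^ 3 + 8 * X ^ 2 * lam + 8 * X ^ 1 * lam * lam).
  exists B, (fun t => RtoC (d1 t)), (fun t => RtoC (d2 t)). split; [|split].
  - intros al be t _.
    assert (Hu : is_derive level t (u1 t)) by apply is_derive_level.
    assert (Hu1 : is_derive u1 t (u2 t)).
    { unfold u1, u2. auto_derive; auto. unfold Rminus. ring. }
    assert (Hcomp : forall n, is_derive (fun s => third_diff (S (S n)) (level s)) t
               (INR (S (S n)) * third_diff (S n) (level t) * u1 t)).
    { intros n. evar_last.
      - apply (is_derive_comp (third_diff (S (S n))) level); [apply is_derive_third_diff|exact Hu].
      - unfold scal; simpl; unfold mult; simpl. ring. }
    assert (D0 : is_derive bump t (d1 t)).
    { unfold bump, step, d1.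
      apply (is_derive_ext (fun s => / 6 * third_diff 3 (level s))); [intros; simpl; field|].
      evar_last; [apply (is_derive_scal (fun s => third_diff 3 (level s))), (Hcomp 1%nat)|].
      simpl; field. }
    assert (D1 : is_derive d1 t (d2 t)).
    { unfold d1, d2.
      evar_last; [apply (is_derive_Rmult (fun s => third_diff 2 (level s) / 2) u1);
        [apply (is_derive_ext (fun s => / 2 * third_diff 2 (level s))); [intros; simpl; field|];
         apply (is_derive_scal (fun s => third_diff 2 (level s))), (Hcomp 0%nat)|exact Hu1]|].
      simpl; field. }
    assert (Cl : forall (v : R -> R) dv, is_derive v t dv -> continuous v t).
    { intros v dv Hv. apply (ex_derive_continuous (V := R_NormedModule)). eexists; exact Hv. }
    assert (C2' : continuous d2 t).
    { unfold d2. apply continuous_Rplus.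
      - apply continuous_Rmult; [apply continuous_Rmult|].
        + apply (continuous_comp level (third_diff 1)); [exact (Cl _ _ Hu)|apply continuous_third_diff_1].
        + exact (Cl _ _ Hu1).
        + exact (Cl _ _ Hu1).
      - apply continuous_Rmult.
        + apply (continuous_Rmult (fun s => third_diff 2 (level s)) (fun _ => / 2)); [|apply continuous_const].
          exact (Cl _ _ (Hcomp 0%nat)).
        + unfold u2. apply (continuous_Rmult (fun _ => - lam)); [apply continuous_const|].
          apply (continuous_comp (fun s => s - t0) cos); [|apply continuous_cos].
          apply continuous_Rminus; [apply continuous_id|apply continuous_const]. }
    assert (HL : Rabs (level t) <= 2 * lam).
    { unfold level. rewrite Rabs_mult, (Rabs_pos_eq lam) by auto.
      rewrite Rmult_comm. apply Rmult_le_compat_r; auto.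
      apply Rabs_le_between in Hc. pose proof (COS_bound (t - t0)). apply Rabs_le. lra. }
    assert (T : forall n, Rabs (third_diff n (level t)) <= 8 * X ^ n).
    { intros n. now apply third_diff_bound. }
    assert (HX : 3 <= X) by (unfold X; lra).
    assert (P1 : 0 <= X ^ 1) by (apply pow_le; lra).
    assert (P2 : 0 <= X ^ 2) by (apply pow_le; lra).
    assert (P3 : 0 <= X ^ 3) by (apply pow_le; lra).
    assert (U1 : Rabs (u1 t) <= lam).
    { unfold u1. rewrite Rabs_mult, Rabs_Ropp, (Rabs_pos_eq lam) by auto.
      pose proof (SIN_bound (t - t0)). assert (Rabs (sin (t - t0)) <= 1) by (apply Rabs_le; lra). nra. }
    assert (U2 : Rabs (u2 t) <= lam).
    { unfold u2. rewrite Rabs_mult, Rabs_Ropp, (Rabs_pos_eq lam) by auto.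
      pose proof (COS_bound (t - t0)). assert (Rabs (cos (t - t0)) <= 1) by (apply Rabs_le; lra). nra. }
    assert (Q2 : 0 <= 8 * X ^ 2 * lam) by (apply Rmult_le_pos; lra).
    assert (Q1 : 0 <= 8 * X ^ 1 * lam * lam) by (apply Rmult_le_pos; [apply Rmult_le_pos|]; lra).
    assert (Hhalf : Rabs (third_diff 2 (level t) / 2) <= 8 * X ^ 2).
    { unfold Rdiv. rewrite Rabs_mult, (Rabs_pos_eq (/ 2)) by lra. specialize (T 2%nat). lra. }
    assert (R1 : Rabs (d1 t) <= 8 * X ^ 2 * lam).
    { unfold d1. rewrite Rabs_mult. apply Rmult_le_compat; auto using Rabs_pos. }
    split_C2.
    + split; simpl; [exact D0|apply (is_derive_const (V := R_NormedModule))].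
    + split; simpl; [exact D1|apply (is_derive_const (V := R_NormedModule))].
    + split; simpl; [exact C2'|apply continuous_const].
    + rewrite Cmod_R. unfold bump, step, Rdiv. rewrite Rabs_mult, (Rabs_pos_eq (/ 6)) by lra.
      specialize (T 3%nat). unfold B. lra.
    + rewrite Cmod_R. unfold B. lra.
    + rewrite Cmod_R. unfold d2. eapply Rle_trans; [apply Rabs_triang|].
      assert (Rabs (third_diff 1 (level t) * u1 t * u1 t) <= 8 * X ^ 1 * lam * lam).
      { rewrite !Rabs_mult. apply Rmult_le_compat; auto using Rabs_pos.
        - apply Rmult_le_pos; apply Rabs_pos.
        - apply Rmult_le_compat; auto using Rabs_pos. }
      assert (Rabs (third_diff 2 (level t) / 2 * u2 t) <= 8 * X ^ 2 * lam).
      { rewrite Rabs_mult. apply Rmult_le_compat; auto using Rabs_pos. }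
      unfold B. lra.
  - intros t Ht. unfold bump, step, d1. rewrite !third_diff_nonpos by auto.
    split; [field|apply C_ext; simpl; field].
  - intros t Ht. unfold bump, d1. destruct (step_ge_3 _ Ht) as [-> ->].
    split; [reflexivity|apply C_ext; simpl; field].
Qed.

Lemma bump_period t : bump (t + 2 * PI) = bump t.
Proof.
  unfold bump, level. do 3 f_equal.
  replace (t + 2 * PI - t0) with (t - t0 + 2 * 1 * PI) by ring.
  change 1 with (INR 1). now rewrite cos_period.
Qed.
End Bump.

Lemma cos_far d x : 0 <= d <= PI -> d <= x <= 2 * PI - d -> cos x <= cos d.
Proof.
  intros Hd Hx. destruct (Rle_dec x PI) as [H|H].
  - apply cos_decr_1; lra.
  - replace (cos x) with (cos (2 * PI - x)).
    + apply cos_decr_1; lra.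
    + rewrite cos_minus, cos_2PI, sin_2PI. ring.
Qed.

Lemma cos_near d x : 0 <= d <= PI -> - d <= x <= d -> cos d <= cos x.
Proof.
  intros Hd Hx. destruct (Rle_dec 0 x) as [H|H].
  - apply cos_decr_1; lra.
  - rewrite <- (cos_neg x). apply cos_decr_1; lra.
Qed.

Lemma cos_2PI_shift x : cos (x - 2 * PI) = cos x.
Proof. rewrite cos_minus, cos_2PI, sin_2PI. ring. Qed.

(** * Analytic continuation across the arc *)

Section Continuation.
Variables (I : open_arc) (b : Z -> C) (M : R) (Hb : zbounded M b).
Hypothesis vanish : forall B g, test (lo I) (hi I) B g -> pairing b (lo I) (hi I) g = RtoC 0.

(** Both the support of the cutoff and the region where it equals 1 are symmetric
    arcs about t0, of half-lengths d' and d = d'/2.  The complementary part of the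
    kernel is paired over [t0 + d, t0 + 2pi - d], an arc on which it is smooth for
    every z near e^{i t0}, on the circle or not. *)
Lemma local_continuation t0 : lo I < t0 < hi I ->
  exists k (G : C -> C), 0 < k /\
    (forall w, Cmod (w - (cos t0, sin t0)) < k -> complex_differentiable G w) /\
    (forall w, Cmod (w - (cos t0, sin t0)) < k -> Cmod w <> 1 ->
       full_cauchy b (lo I) w = G w).
Proof.
  intros Ht0. pose proof PI_RGT_0 as HPI. pose proof (lo_lt_hi I) as Hlh. pose proof (hi_le I) as Hle.
  set (d' := Rmin (t0 - lo I) (hi I - t0)).
  assert (Hd'0 : 0 < d') by (apply Rmin_glb_lt; lra).
  assert (Hd'1 : d' <= t0 - lo I) by apply Rmin_l.
  assert (Hd'2 : d' <= hi I - t0) by apply Rmin_r.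
  set (d := d' / 2).
  assert (Hd : 0 < d < d') by (unfold d; lra).
  assert (Hcos : cos d' < cos d) by (apply cos_decreasing_1; lra).
  (* the slope for which the cutoff starts at distance d' from t0 and reaches 1 at d *)
  set (lam := 3 / (cos d - cos d')).
  assert (Hlam : 0 < lam) by (apply Rdiv_lt_0_compat; lra).
  assert (Hc1 : Rabs (cos d') <= 1) by (apply Rabs_le, COS_bound).
  destruct (C2_bump t0 lam (cos d') (Rlt_le _ _ Hlam) Hc1) as (B & b1 & b2 & HC & Hzero & Hone).
  set (phi := bump t0 lam (cos d')) in *.
  assert (Lev0 : forall x, cos (x - t0) <= cos d' -> level t0 lam (cos d') x <= 0).
  { intros x Hx. unfold level. nra. }
  assert (Lev3 : forall x, cos d <= cos (x - t0) -> 3 <= level t0 lam (cos d') x).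
  { intros x Hx. unfold level. replace 3 with (lam * (cos d - cos d')) at 1
      by (unfold lam; field; lra). apply Rmult_le_compat_l; lra. }
  set (al := t0 + d). set (be := t0 + 2 * PI - d).
  assert (Hab : al <= be) by (unfold al, be; lra).
  assert (Hlo : cos (lo I - t0) <= cos d').
  { rewrite <- cos_neg. apply cos_far; lra. }
  assert (Hhi : cos (hi I - t0) <= cos d') by (apply cos_far; lra).
  assert (Hal : cos d <= cos (al - t0)) by (unfold al; right; f_equal; ring).
  assert (Hbe : cos d <= cos (be - t0)).
  { unfold be. rewrite <- (cos_2PI_shift (t0 + 2 * PI - d - t0)), <- cos_neg. right; f_equal; ring. }
  assert (Tphi : test (lo I) (hi I) B (fun t => RtoC (phi t))).
  { exists b1, b2. split; [apply HC|]. right.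
    destruct (Hzero (lo I)) as [-> ->]; [now apply Lev0|].
    destruct (Hzero (hi I)) as [-> ->]; [now apply Lev0|]. auto. }
  set (eta := fun t => (RtoC 1 + - RtoC 1 * RtoC (phi t))%C).
  assert (Teta : test al be (1 + B) eta).
  { exists (fun t => - RtoC 1 * b1 t)%C, (fun t => - RtoC 1 * b2 t)%C. split.
    - intros t Ht. destruct (HC al be t Ht) as (D0 & D1 & Cc & B0 & B1 & B2).
      assert (N : forall v, Cmod (- RtoC 1 * v) = Cmod v).
      { intros v. rewrite Cmod_mult, Cmod_opp, Cmod_1. ring. }
      split_C2.
      + eapply cder_eq.
        * apply cder_plus; [apply cder_const|].
          apply (cder_mult (fun _ => - RtoC 1)%C (fun t => RtoC (phi t))); [apply cder_const|exact D0].
        * ring.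
      + eapply cder_eq.
        * apply (cder_mult (fun _ => - RtoC 1)%C b1); [apply cder_const|exact D1].
        * ring.
      + apply ccont_mult; [apply ccont_const|exact Cc].
      + unfold eta. eapply Rle_trans; [apply Cmod_triangle|]. rewrite N, Cmod_1. lra.
      + rewrite N. lra.
      + rewrite N. lra.
    - right. unfold eta.
      destruct (Hone al) as [-> ->]; [now apply Lev3|].
      destruct (Hone be) as [-> ->]; [now apply Lev3|]. repeat split; ring. }
  set (z0 := (cos t0, sin t0) : C).
  assert (Hs0 : 0 < sqrt (2 - 2 * cos d)).
  { apply sqrt_lt_R0. assert (cos d < cos 0) by (apply cos_decreasing_1; lra).
    rewrite cos_0 in *. lra. }
  set (k := Rmin 1 (sqrt (2 - 2 * cos d))).
  assert (Hk : 0 < k <= 1) by (unfold k; split; [apply Rmin_glb_lt; lra|apply Rmin_l]).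
  assert (Hoff : off_arc al be k z0).
  { intros t Ht. eapply Rle_trans; [apply Rmin_r|]. unfold Cmod. apply sqrt_le_1_alt.
    assert (E : (z0 * e (-1) t)%C = (cos (t - t0), - sin (t - t0))).
    { unfold z0, e. rewrite cos_minus, sin_minus.
      replace (IZR (-1) * t) with (- t) by ring. rewrite cos_neg, sin_neg.
      apply C_ext; simpl; ring. }
    rewrite E. simpl.
    assert (cos (t - t0) <= cos d) by (apply cos_far; unfold al, be in Ht; lra).
    pose proof (sin2_cos2 (t - t0)) as S. unfold Rsqr in S. nra. }
  exists (k / 2), (cauchy_transform b al be eta). split; [lra|]. split.
  { intros w Hw. apply (cauchy_differentiable al be M b (1 + B) eta (k / 2)); auto; [lra|].
    apply off_arc_near with z0; auto. lra. }
  intros w Hw Hw1.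
  destruct (off_circle_arc (lo I) (hi I) w Hw1) as (k1 & Hk1 & Ho1).
  assert (TphiK := test_mult _ _ _ _ _ _ Tphi (multiplier_kernel _ _ k1 w Hk1 Ho1)).
  assert (Ho2 : off_arc al be (k / 2) w) by (apply off_arc_near with z0; auto; lra).
  assert (TetaK := test_mult _ _ _ _ _ _ Teta
    (multiplier_kernel _ _ (k / 2) w ltac:(lra) Ho2)).
  assert (HV := vanish _ _ TphiK).
  rewrite full_cauchy_fourier. unfold cauchy_transform.
  transitivity (pairing b (lo I) (hi I) (fun t => RtoC (phi t) * kernel w t)%C
                + pairing b al be (fun t => eta t * kernel w t)%C)%C.
  2:{ rewrite HV. ring. }
  assert (D1 := pairing_dominated _ _ (Rlt_le _ _ Hlh) M b Hb _ _ TphiK).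
  assert (D2 := pairing_dominated _ _ Hab M b Hb _ _ TetaK).
  set (K1 := M * _) in D1. set (K2 := M * _) in D2.
  unfold pairing. rewrite <- (Zsum_plus (K1 + K2)).
  2:{ eapply quad_dominated_weaken; [|exact D1].
      pose proof (quad_dominated_nonneg _ _ D2). lra. }
  2:{ eapply quad_dominated_weaken; [|exact D2].
      pose proof (quad_dominated_nonneg _ _ D1). lra. }
  apply Zsum_ext. intros n. rewrite <- Cmult_plus_distr_l. f_equal.
  assert (Cphi : forall t, ccont (fun t => RtoC (phi t)) t).
  { intros t. destruct (HC t t t) as [D _]; [lra|]. exact (cder_ccont _ _ _ D). }
  assert (Ceta : forall t, ccont eta t).
  { intros t. apply ccont_plus; [apply ccont_const|]. apply ccont_mult; [apply ccont_const|apply Cphi]. }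
  assert (CK := kernel_ccont w Hw1).
  set (f1 := fun t => (RtoC (phi t) * kernel w t * e n t)%C).
  set (f2 := fun t => (eta t * kernel w t * e n t)%C).
  assert (Cf1 : forall t, ccont f1 t).
  { intros t. apply ccont_mult; [apply ccont_mult; auto|apply ccont_e]. }
  assert (Cf2 : forall t, ccont f2 t).
  { intros t. apply ccont_mult; [apply ccont_mult; auto|apply ccont_e]. }
  unfold fourier. fold f1 f2.
  transitivity (CInt f1 (lo I) (lo I + 2 * PI) + CInt f2 (lo I) (lo I + 2 * PI))%C.
  { rewrite <- CInt_plus; try lra; try (intros ? _; auto).
    apply CInt_ext; [lra|]. intros t _. unfold f1, f2, eta. ring. }
  f_equal.
  - rewrite (CInt_Chasles f1 (lo I) (hi I)) by (try lra; intros ? _; auto).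
    rewrite (CInt_0 (hi I)); [ring|lra|].
    intros t Ht. unfold f1. destruct (Hzero t) as [-> _]; [|ring].
    apply Lev0. apply cos_far; lra.
  - rewrite (CInt_period f2 (lo I) al); auto; [|unfold al; lra|].
    + rewrite (CInt_Chasles f2 al be) by (unfold al, be in *; try lra; intros ? _; auto).
      rewrite (CInt_0 be); [ring|unfold al, be; lra|].
      intros t Ht. unfold f2, eta. destruct (Hone t) as [-> _]; [|ring].
      apply Lev3. rewrite <- (cos_2PI_shift (t - t0)). unfold al, be in Ht. apply cos_near; lra.
    + intros t. unfold f2, eta, phi. now rewrite kernel_period, e_period, bump_period.
Qed.

(** Radial limits give the values on the arc without choosing a local
    continuation at each point. *)
Definition boundary_value (z : C) : C :=
  (real (Lim_seq (fun j => Re (f_plus b (RtoC (radius j) * z)))),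
   real (Lim_seq (fun j => Im (f_plus b (RtoC (radius j) * z))))).

Definition continuation (x : sphere) : C :=
  match x with
  | None => RtoC 0
  | Some z =>
      if Rlt_dec (Cmod z) 1 then f_plus b z
      else if Rlt_dec 1 (Cmod z) then (- f_minus b (Some z))%C
      else boundary_value z
  end.

Lemma continuation_off_circle z : Cmod z <> 1 ->
  continuation (Some z) = (RtoC (/ (2 * PI)) * full_cauchy b (lo I) z)%C.
Proof.
  intros Hz. pose proof PI_RGT_0.
  assert (E : (RtoC (/ (2 * PI)) * RtoC (2 * PI))%C = RtoC 1).
  { rewrite <- RtoC_mult. f_equal. field. lra. }
  unfold continuation. destruct (Rlt_dec (Cmod z) 1) as [H1|H1]; [|destruct (Rlt_dec 1 (Cmod z)) as [H2|H2]; [|lra]].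
  - rewrite full_cauchy_inside, Cmult_assoc, E by auto. ring.
  - rewrite full_cauchy_outside, Cmult_assoc, RtoC_opp by auto.
    transitivity (- (RtoC (/ (2 * PI)) * RtoC (2 * PI)) * f_minus b (Some z))%C; [|ring].
    rewrite E. ring.
Qed.

Lemma Clim_boundary_value z l :
  Clim (fun j => f_plus b (RtoC (radius j) * z)%C) l -> boundary_value z = l.
Proof.
  intros [H1 H2]. unfold boundary_value.
  apply is_lim_seq_unique in H1, H2. rewrite H1, H2. now apply C_ext.
Qed.

Lemma Clim_radius z : Clim (fun j => RtoC (radius j) * z)%C z.
Proof.
  pose proof (Clim_mult (fun j => RtoC (radius j)) (fun _ => z) (RtoC 1) z) as H.
  rewrite Cmult_1_l in H. apply H; [|apply Clim_const]. split; simpl; [apply is_lim_radius|apply is_lim_seq_const].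
Qed.

(** The local continuation is continuous at the points of the circle near e^{i t0},
    so the radial limits there exist and are its values. *)
Lemma continuation_differentiable_arc t0 : lo I < t0 < hi I ->
  complex_differentiable (fun w => continuation (Some w)) (cos t0, sin t0).
Proof.
  intros Ht0. pose proof PI_RGT_0.
  destruct (local_continuation t0 Ht0) as (k & G & Hk & HG & HE).
  set (z0 := (cos t0, sin t0) : C) in *.
  apply (complex_differentiable_near (fun w => RtoC (/ (2 * PI)) * G w)%C _ z0 k Hk).
  2:{ apply complex_differentiable_scal, HG. replace (z0 - z0)%C with (RtoC 0) by ring.
      now rewrite Cmod_0. }
  intros w Hw. symmetry.
  destruct (Req_dec (Cmod w) 1) as [H1|H1].
  2:{ rewrite continuation_off_circle by auto. now rewrite HE. }
  simpl. destruct (Rlt_dec (Cmod w) 1) as [?|_]; [lra|]. destruct (Rlt_dec 1 (Cmod w)) as [?|_]; [lra|].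
  apply Clim_boundary_value.
  assert (HL := Clim_radius w).
  assert (HL2 := complex_differentiable_Clim _ w _
     (complex_differentiable_scal (RtoC (/ (2 * PI))) G w (HG w Hw)) HL).
  eapply Clim_ext_loc; [|exact HL2].
  apply Clim_Cmod in HL. apply is_lim_seq_spec in HL.
  assert (Hgap : 0 < k - Cmod (w - z0)) by lra.
  destruct (HL (mkposreal _ Hgap)) as [N HN]. exists N. intros j Hj. specialize (HN j Hj).
  simpl in HN. rewrite Rminus_0_r, Rabs_pos_eq in HN by apply Cmod_ge_0.
  set (v := (RtoC (radius j) * w)%C) in *.
  assert (Hv : Cmod v < 1).
  { unfold v. rewrite Cmod_mult, H1, Cmod_R. pose proof (radius_bounds j) as R.
    rewrite Rabs_pos_eq; lra. }
  assert (Hvk : Cmod (v - z0) < k).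
  { replace (v - z0)%C with ((v - w) + (w - z0))%C by ring.
    eapply Rle_lt_trans; [apply Cmod_triangle|]. change (Cmod (v - w) < k - Cmod (w - z0)) in HN. lra. }
  rewrite <- (HE v Hvk) by lra.
  rewrite <- continuation_off_circle by lra. simpl. destruct (Rlt_dec (Cmod v) 1); [auto|lra].
Qed.

Lemma continuation_differentiable_off z : Cmod z <> 1 ->
  complex_differentiable (fun w => continuation (Some w)) z.
Proof.
  intros Hz.
  assert (Hd : 0 < Rabs (1 - Cmod z)) by (apply Rabs_pos_lt; lra).
  apply (complex_differentiable_near (fun w => RtoC (/ (2 * PI)) * full_cauchy b (lo I) w)%C _ z _ Hd).
  - intros w Hw. symmetry. apply continuation_off_circle. intros H1.
    assert (T1 : Cmod w <= Cmod (w - z) + Cmod z).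
    { replace w with ((w - z) + z)%C at 1 by ring. apply Cmod_triangle. }
    assert (T2 : Cmod z <= Cmod (w - z) + Cmod w).
    { replace z with (- (w - z) + w)%C at 1 by ring. eapply Rle_trans; [apply Cmod_triangle|].
      rewrite Cmod_opp. lra. }
    apply (Rlt_irrefl (Rabs (1 - Cmod z))).
    eapply Rle_lt_trans; [|exact Hw]. apply Rabs_le. lra.
  - apply complex_differentiable_scal. eapply full_cauchy_differentiable; eauto.
Qed.

(** In the chart w = 1/z the exterior function is minus the power series with
    coefficients b_{-n}, n >= 1. *)
Lemma continuation_differentiable_infinity :
  complex_differentiable (fun w => continuation (inversion w)) (RtoC 0).
Proof.
  set (b' := fun n => match n with O => RtoC 0 | S m => b (- Z.of_nat (S m))%Z end).
  assert (Hb' : forall n, Cmod (b' n) <= M).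
  { intros [|n]; simpl b'; [|apply Hb]. rewrite Cmod_0. eapply Rle_trans; [apply Cmod_ge_0|apply (Hb 0%Z)]. }
  apply (complex_differentiable_near (fun w => - RtoC 1 * power_series b' w)%C _ _ 1 Rlt_0_1).
  2:{ apply complex_differentiable_scal. apply (power_series_differentiable M b' Hb').
      rewrite Cmod_0. lra. }
  intros w Hw. replace (w - 0)%C with w in Hw by ring.
  assert (E : power_series b' w = CSeries (fun m => b (- Z.of_nat (S m))%Z * w ^ S m)%C).
  { unfold power_series, CSeries. f_equal; apply Series_incr_1_aux; simpl; ring. }
  rewrite E. unfold inversion. destruct (Ceq_dec w (RtoC 0)) as [->|Hw0].
  - rewrite (CSeries_ext _ (fun _ => RtoC 0)); [rewrite CSeries_0; unfold continuation; ring|].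
    intros n. rewrite Cpow_S. ring.
  - assert (H0 : 0 < Cmod w) by now apply Cmod_gt_0.
    assert (H1 : 1 < Cmod (/ w)).
    { rewrite Cmod_inv by auto. rewrite <- Rinv_1. apply Rinv_lt_contravar; lra. }
    unfold continuation. destruct (Rlt_dec (Cmod (/ w)) 1) as [?|_]; [lra|].
    destruct (Rlt_dec 1 (Cmod (/ w))) as [_|?]; [|lra].
    transitivity (- CSeries (fun m => b (- Z.of_nat (S m))%Z * w ^ S m))%C; [ring|].
    f_equal. apply CSeries_ext. intros n. f_equal.
    rewrite Cpow_inv by auto. field. now apply Cpow_nz.
Qed.

Theorem pairing_vanishes_reflectionless : reflectionless b I.
Proof.
  exists continuation. split; [|split].
  - intros [z|] Hx; simpl in *.
    + destruct (Req_dec (Cmod z) 1) as [H1|H1].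
      * destruct (classic (in_arc I z)) as [(t & Ht & ->)|Hn]; [|tauto].
        now apply continuation_differentiable_arc.
      * now apply continuation_differentiable_off.
    + apply continuation_differentiable_infinity.
  - intros z Hz. simpl. destruct (Rlt_dec (Cmod z) 1); [auto|lra].
  - intros [z|] Hx; simpl in *; [|ring].
    destruct (Rlt_dec (Cmod z) 1); [lra|]. destruct (Rlt_dec 1 (Cmod z)); [|lra].
    unfold f_minus. ring.
Qed.
End Continuation.

Theorem corollary1p5 (a : nat -> C) (ha : bounded_seq a)
  (hright : forall I : open_arc,
     exists b : Z -> C, right_limit a b /\ ~ reflectionless b I) :
  strong_natural_boundary (power_series a).
Proof.
  destruct ha as [M Ha]. split; [exact (power_series_differentiable M a Ha)|].
  intros I. destruct (hright I) as (b & Hb & Hn).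
  set (E := fun x => exists r, 0 < r < 1 /\ x = arc_mean (power_series a) I r).
  destruct (Lub_Rbar_correct E) as [Hub _].
  assert (Hfin : forall A : R, ~ (forall r, 0 < r < 1 -> arc_mean (power_series a) I r <= A)).
  { intros A HA. apply Hn. apply (pairing_vanishes_reflectionless I b M).
    - exact (right_limit_bounded a M Ha b Hb).
    - intros B g. exact (right_limit_pairing_vanishes a M Ha I A HA b B g Hb). }
  destruct (Lub_Rbar E) as [A| |] eqn:EL; auto; exfalso.
  - apply (Hfin A). intros r Hr. apply (Hub (arc_mean (power_series a) I r)). exists r; auto.
  - apply (Hub (arc_mean (power_series a) I (1 / 2))). exists (1 / 2). split; [lra|auto].
Qed.
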